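(* Let $A$ be a real $2\times2$ matrix with $(\operatorname{tr}A)^2-4\det A<0$ and $\operatorname{tr}A\neq0$, let $\eta\in\mathbb{R}^2\setminus\{0\}$, and let $\Omega=[u^-,u^+]$ with $u^-<u^+$. Let $\mathcal{C}$ be the closure of the region delimited by the periodic orbit $\mathcal{O}$ (defined in the context) of the linear control system $\dot v=Av+u\eta$, $u\in\Omega$. Then: 1. if $\operatorname{tr}A<0$, then $D=\mathcal{C}$ is a control set of the system; 2. if $\operatorname{tr}A>0$, then $D=\operatorname{int}\mathcal{C}$ is a control set of the system.
   Context: Control functions: $\mathcal{U}$ is the set of all piecewise constant functions $\mathbf{u}:\mathbb{R}\to\Omega$ (finitely many discontinuities on each bounded interval). For $v\in\mathbb{R}^2$ and $\mathbf{u}\in\mathcal{U}$, $s\in\mathbb{R}\mapsto\varphi(s,v,\mathbf{u})$ is the unique continuous, piecewise differentiable curve with $\varphi(0,v,\mathbf{u})=v$ and $\frac{d}{ds}\varphi(s,v,\mathbf{u})=A\varphi(s,v,\mathbf{u})+\mathbf{u}(s)\eta$ (away from the discontinuities of $\mathbf{u}$). For $u\in\Omega$, $\varphi(s,v,u)$ denotes the solution for the constant control $u$; explicitly, $\varphi(s,v,u)=e^{sA}(v-v(u))+v(u)$ with $v(u)=-uA^{-1}\eta$. The positive orbit of $v$ is $\mathcal{O}^+(v)=\{\varphi(s,v,\mathbf{u}) : s\ge0,\ \mathbf{u}\in\mathcal{U}\}$. A control set of the system is a subset $D\subset\mathbb{R}^2$ such that: (a) for every $v\in D$ there exists $\mathbf{u}\in\mathcal{U}$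 with $\varphi(s,v,\mathbf{u})\in D$ for all $s\ge0$; (b) for every $v\in D$, $D\subset\overline{\mathcal{O}^+(v)}$; (c) $D$ is maximal with respect to set inclusion among sets satisfying (a) and (b). Let $\lambda\pm i\mu$, $\mu>0$, be the eigenvalues of $A$ (so $2\lambda=\operatorname{tr}A$), and $$P^+:=\left(\frac{-u^++e^{\pi\lambda/\mu}u^-}{1-e^{\pi\lambda/\mu}}\right)A^{-1}\eta,\qquad P^-:=\left(\frac{-u^-+e^{\pi\lambda/\mu}u^+}{1-e^{\pi\lambda/\mu}}\right)A^{-1}\eta.$$ The periodic orbit $\mathcal{O}$ is the closed curve $$\mathcal{O}:=\left\{\varphi(s,P^+,u^-) : s\in\left[0,\tfrac{\pi}{\mu}\right]\right\}\cup\left\{\varphi(s,P^-,u^+) : s\in\left[0,\tfrac{\pi}{\mu}\right]\right\}.$$ The region delimited by $\mathcal{O}$ is the bounded connected component of $\mathbb{R}^2\setminus\mathcal{O}$, and $\mathcal{C}$ is its closure. *)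

(* Defs.v *)
From HB Require Import structures.
From mathcomp Require Import all_boot all_order all_algebra.
From mathcomp Require Import complex.
From mathcomp Require Import all_classical all_reals all_analysis.

Set Implicit Arguments.
Unset Strict Implicit.
Unset Printing Implicit Defensive.

Import Order.TTheory GRing.Theory Num.Theory.
Import numFieldNormedType.Exports.

Local Open Scope classical_set_scope.
Local Open Scope ring_scope.

Definition complex_eigenvalues (R : realType) (A : 'M[R]_2)
    (lambda mu : R) : Prop :=
  eigenvalue (map_mx (real_complex R) A) (lambda +i* mu)%C /\
  eigenvalue (map_mx (real_complex R) A) (lambda -i* mu)%C.

Definition discontinuities (R : realType) (u : R -> R) : set R :=
  [set s | ~ {for s, continuous u}].

(* Since the discontinuities are locally finite, being locally constant at
   every other point means being constant on each open interval between
   consecutive discontinuities; the values at the discontinuities are free. *)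
Definition piecewise_constant (R : realType) (u : R -> R) : Prop :=
  (forall a b : R, finite_set (discontinuities u `&` `[a, b])) /\
  (forall s, ~ discontinuities u s -> \forall t \near s, u t = u s).

Definition control_functions (R : realType) (Omega : set R) : set (R -> R) :=
  [set u | piecewise_constant u /\ forall s, Omega (u s)].

(* [is_phi A eta v u x] says that [x] is the curve [s |-> phi(s, v, u)]; for a
   piecewise constant [u] such an [x] exists and is unique. *)
Definition is_phi (R : realType) (A : 'M[R]_2) (eta v : 'cV[R]_2)
    (u : R -> R) (x : R -> 'cV[R]_2) : Prop :=
  [/\ continuous x,
      x 0 = v &
      forall s, ~ discontinuities u s ->
        is_derive s 1 x (A *m x s + u s *: eta)].

Definition positive_orbit (R : realType) (A : 'M[R]_2) (eta : 'cV[R]_2)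
    (Omega : set R) (v : 'cV[R]_2) : set 'cV[R]_2 :=
  [set w | exists u x s, [/\ control_functions Omega u, is_phi A eta v u x,
                             0 <= s & w = x s]].

Definition controlled_invariant (R : realType) (A : 'M[R]_2) (eta : 'cV[R]_2)
    (Omega : set R) (D : set 'cV[R]_2) : Prop :=
  forall v, D v -> exists u x,
    [/\ control_functions Omega u, is_phi A eta v u x &
        forall s, 0 <= s -> D (x s)].

Definition approx_controllable (R : realType) (A : 'M[R]_2) (eta : 'cV[R]_2)
    (Omega : set R) (D : set 'cV[R]_2) : Prop :=
  forall v, D v -> D `<=` closure (positive_orbit A eta Omega v).

Definition control_set (R : realType) (A : 'M[R]_2) (eta : 'cV[R]_2)
    (Omega : set R) (D : set 'cV[R]_2) : Prop :=
  [/\ controlled_invariant A eta Omega D,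
      approx_controllable A eta Omega D &
      forall D' : set 'cV[R]_2,
        controlled_invariant A eta Omega D' ->
        approx_controllable A eta Omega D' ->
        D `<=` D' -> D' = D].

(* [switch_point A eta lambda mu a b] is
   ((- a + e^(pi lambda / mu) b) / (1 - e^(pi lambda / mu))) A^-1 eta, so that
   P^+ is [switch_point A eta lambda mu u^+ u^-] and
   P^- is [switch_point A eta lambda mu u^- u^+]. *)
Definition switch_point (R : realType) (A : 'M[R]_2) (eta : 'cV[R]_2)
    (lambda mu a b : R) : 'cV[R]_2 :=
  ((- a + expR (pi * lambda / mu) * b) / (1 - expR (pi * lambda / mu)))
    *: (invmx A *m eta).

Definition constant_arc (R : realType) (A : 'M[R]_2) (eta : 'cV[R]_2)
    (mu : R) (v : 'cV[R]_2) (c : R) : set 'cV[R]_2 :=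
  [set w | exists x s, [/\ is_phi A eta v (cst c) x, s \in `[0, pi / mu] &
                           w = x s]].

Definition periodic_orbit (R : realType) (A : 'M[R]_2) (eta : 'cV[R]_2)
    (lambda mu um up : R) : set 'cV[R]_2 :=
  constant_arc A eta mu (switch_point A eta lambda mu up um) um `|`
  constant_arc A eta mu (switch_point A eta lambda mu um up) up.

Definition bounded_component (R : realType) (U B : set 'cV[R]_2) : Prop :=
  (exists2 x, U x & B = connected_component U x) /\ bounded_set B.

(* The bounded component of the complement of a closed curve [K]; it exists and
   is unique when [K] is a Jordan curve ([set0] is only a default value). *)
Definition delimited_region (R : realType) (K : set 'cV[R]_2) :
    set 'cV[R]_2 :=
  xget set0 [set B | bounded_component (~` K) B].

(* Main.v *)
(** In the basis [eta], [J eta] (with [J = (A - lambda) / mu], [J ^ 2 = -1]),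
    centred at the equilibrium of the mean control, the plane becomes [C] and the
    system [z' = alpha z + u] with [alpha = lambda + i mu] and [|u| <= 1].

    Let [lambda < 0].  Along any trajectory the form
    [W_s(z) = Re (i e^(- alpha s) z)], whose normal rotates with the flow, changes
    at the rate [e^(- lambda s) sin (mu s) u], hence at most as fast as the value
    [H s] of the same form on the periodic orbit.  So
    [F z = sup_{0 <= s <= pi / mu} |W_s z| / H s] is a norm whose open and closed
    unit balls are positively invariant; its unit sphere is exactly the periodic
    orbit, because a point where [W_s] touches [H s] is a minimum in [s], which
    gives a second linear equation.  Hence the region delimited by the orbit is
    [F < 1].  Every point of [F <= 1] is approached from every starting point:
    going backwards with the mean control it meets the orbit, and the loop of
    controls that runs once through the orbit contracts the plane to its starting
    point by the factor [e^(2 pi lambda / mu)].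

    The case [lambda > 0] is the time reversal: [(- A, - eta)] has the same
    periodic orbit.  There approximate reachability becomes exact on [F < 1],
    since two short steps with free controls map onto a neighbourhood. *)
Require Import Defs.
From mathcomp Require Import all_boot all_order all_algebra.
From mathcomp Require Import ring lra.
From mathcomp Require Import complex.
From mathcomp Require Import all_classical all_reals all_analysis.

Set Implicit Arguments.
Unset Strict Implicit.
Unset Printing Implicit Defensive.

Import Order.TTheory GRing.Theory Num.Theory.
Import numFieldNormedType.Exports.

Local Open Scope classical_set_scope.
Local Open Scope ring_scope.

(** * Real calculus: pointwise derivatives and monotonicity *)

Section PointwiseDerivative.
Context {R : realType}.
Implicit Types (f g : R -> R) (s a b c : R).

Lemma is_derive_addf f g s a b : is_derive s 1 f a -> is_derive s 1 g b ->
  is_derive s 1 (fun t => f t + g t) (a + b).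
Proof. by move=> df dg; exact: (is_deriveD (f := f) (g := g)). Qed.

Lemma is_derive_oppf f s a : is_derive s 1 f a ->
  is_derive s 1 (fun t => - f t) (- a).
Proof. by move=> df; exact: (is_deriveN (f := f)). Qed.

Lemma is_derive_mulf f g s a b : is_derive s 1 f a -> is_derive s 1 g b ->
  is_derive s 1 (fun t => f t * g t) (a * g s + f s * b).
Proof.
move=> df dg; have dfg := is_deriveM df dg.
rewrite (_ : a * g s + f s * b = f s *: b + g s *: a); first exact: dfg.
by rewrite /GRing.scale /= addrC [g s * a]mulrC.
Qed.

Lemma is_derive_cosf f s a : is_derive s 1 f a ->
  is_derive s 1 (fun t => cos (f t)) (- sin (f s) * a).
Proof. by move=> df; exact: (is_derive1_comp (f := cos) (g := f)). Qed.

Lemma is_derive_sinf f s a : is_derive s 1 f a ->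
  is_derive s 1 (fun t => sin (f t)) (cos (f s) * a).
Proof. by move=> df; exact: (is_derive1_comp (f := sin) (g := f)). Qed.

Lemma is_derive_expRf f s a : is_derive s 1 f a ->
  is_derive s 1 (fun t => expR (f t)) (expR (f s) * a).
Proof. by move=> df; exact: (is_derive1_comp (f := expR) (g := f)). Qed.

Lemma is_derive_idf s : is_derive s 1 (fun t : R => t) 1.
Proof. exact: is_derive_id. Qed.

Lemma is_derive_constf c s : is_derive s 1 (fun=> c) 0.
Proof. exact: is_derive_cst. Qed.

Lemma continuous_is_derive f f' : (forall s, is_derive s 1 f (f' s)) ->
  continuous f.
Proof.
move=> df s; apply: differentiable_continuous.
by apply/derivable1_diffP; case: (df s).
Qed.

(* Split the interval at each exceptional point. *)
Lemma ler0_derive_nincr_off (l : seq R) f f' (a b : R) : continuous f ->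
  (forall s, a < s < b -> s \notin l -> is_derive s 1 f (f' s)) ->
  (forall s, a < s < b -> s \notin l -> f' s <= 0) ->
  a <= b -> f b <= f a.
Proof.
move=> cf; elim: l a b => [|c l IHl] a b df f'0 ab.
  have dfs s : s \in `]a, b[ -> is_derive s 1 f (f' s).
    by rewrite in_itv => /df; apply.
  apply: (@ler0_derive1_le_cc _ f a b) => //.
  - by move=> s /dfs [].
  - move=> s sab; rewrite derive1E; case: (dfs _ sab) => _ ->.
    by apply: f'0 => //; rewrite in_itv in sab.
  - exact: continuous_subspaceT.
  - by rewrite in_itv /= lexx ab.
  - by rewrite in_itv /= lexx ab.
have [/andP[ac cb]|cab] := boolP (a < c < b); last first.
  apply: IHl => // s sab sl; [apply: df|apply: f'0] => //;
  by rewrite inE negb_or sl andbT; apply: contraNneq cab => <-.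
apply: (@le_trans _ _ (f c)); apply: IHl; rewrite ?(ltW ac) ?(ltW cb) //.
- move=> s /andP[cs sb] sl; apply: df; first by rewrite sb (lt_trans ac cs).
  by rewrite inE negb_or sl gt_eqF.
- move=> s /andP[cs sb] sl; apply: f'0; first by rewrite sb (lt_trans ac cs).
  by rewrite inE negb_or sl gt_eqF.
- move=> s /andP[cs sb] sl; apply: df; first by rewrite cs (lt_trans sb cb).
  by rewrite inE negb_or sl lt_eqF.
- move=> s /andP[cs sb] sl; apply: f'0; first by rewrite cs (lt_trans sb cb).
  by rewrite inE negb_or sl lt_eqF.
Qed.

End PointwiseDerivative.

(* [notypeclasses refine] keeps the instances of [is_derive] from closing the
   premises with derivatives that are not in normal form. *)
Ltac derive_step :=
  first [ eassumption
        | notypeclasses refine (is_derive_constf _ _)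
        | notypeclasses refine (is_derive_idf _)
        | notypeclasses refine (is_derive_addf _ _)
        | notypeclasses refine (is_derive_oppf _)
        | notypeclasses refine (is_derive_expRf _)
        | notypeclasses refine (is_derive_cosf _)
        | notypeclasses refine (is_derive_sinf _)
        | notypeclasses refine (is_derive_mulf _ _) ].
Ltac derive_by :=
  notypeclasses refine (is_derive_eq _ _); [repeat derive_step | cbv beta].

(** * Logarithmic spirals and their support function *)

Section SpiralFunctionals.
Context {R : realType}.
Variables l m : R.
Implicit Types r s t x y : R.

Definition halfturn : R := pi / m.
Definition decay : R := expR (pi * l / m).
Definition sqmod : R := l ^+ 2 + m ^+ 2.

(** Real and imaginary parts of [e^(alpha s)], where [alpha = l + i m]. *)
Definition spiral_re s : R := expR (l * s) * cos (m * s).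
Definition spiral_im s : R := expR (l * s) * sin (m * s).

(** With [flowy], the solution [e^(alpha s) (z + c / alpha) - c / alpha] of [z' = alpha z + c]
    starting at [z = x + i y]; here [1 / alpha = (l - i m) / sqmod]. *)
Definition flowx c s x y : R :=
  spiral_re s * (x + c * (l / sqmod)) - spiral_im s * (y - c * (m / sqmod))
  - c * (l / sqmod).
Definition flowy c s x y : R :=
  spiral_im s * (x + c * (l / sqmod)) + spiral_re s * (y - c * (m / sqmod))
  + c * (m / sqmod).

Definition normal_form s x y : R :=
  expR (- (l * s)) * (sin (m * s) * x - cos (m * s) * y).
(** The primitive, vanishing at 0, of [e^(- l s) sin (m s)], which is the rate at which the control
    1 raises the rotating form. *)
Definition gain s : R :=
  (m - expR (- (l * s)) * (m * cos (m * s) + l * sin (m * s))) / sqmod.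
(** Under the control 1 a half turn multiplies by [- q], [q = decay], about [- 1 / alpha]. This
    value of [p] solves [- q (p + 1) - 1 = - p], so that [p / alpha] is sent to [- p / alpha]. *)
Definition apex : R := (1 + decay) / (1 - decay).
Definition support s : R := apex * (m / sqmod) + gain s.

Local Notation T := halfturn.
Local Notation q := decay.
Local Notation W := normal_form.
Local Notation H := support.

Hypothesis m_gt0 : 0 < m.

Let m_neq0 : m != 0. Proof. exact: lt0r_neq0. Qed.

Lemma sqmod_gt0 : 0 < sqmod.
Proof. by rewrite /sqmod ltr_wpDl ?sqr_ge0 ?exprn_gt0. Qed.

Lemma sqmod_neq0 : sqmod != 0.
Proof. exact: lt0r_neq0 sqmod_gt0. Qed.

Lemma halfturn_gt0 : 0 < T.
Proof. by rewrite divr_gt0 ?pi_gt0. Qed.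

Lemma mul_halfturn : m * T = pi.
Proof. by rewrite /halfturn mulrC divfK. Qed.

Lemma decay_gt0 : 0 < q. Proof. exact: expR_gt0. Qed.

Lemma expR_halfturn : expR (l * T) = q.
Proof. by rewrite /decay /halfturn mulrA [l * pi]mulrC. Qed.

Lemma spiral_re0 : spiral_re 0 = 1.
Proof. by rewrite /spiral_re !mulr0 expR0 cos0 mulr1. Qed.

Lemma spiral_im0 : spiral_im 0 = 0.
Proof. by rewrite /spiral_im !mulr0 sin0 mulr0. Qed.

Lemma spiral_re_halfturn : spiral_re T = - q.
Proof. by rewrite /spiral_re expR_halfturn mul_halfturn cospi mulrN1. Qed.

Lemma spiral_im_halfturn : spiral_im T = 0.
Proof. by rewrite /spiral_im mul_halfturn sinpi mulr0. Qed.

Lemma spiral_reD s t :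
  spiral_re (s + t) = spiral_re s * spiral_re t - spiral_im s * spiral_im t.
Proof. by rewrite /spiral_re /spiral_im !mulrDr expRD cosD; ring. Qed.

Lemma spiral_imD s t :
  spiral_im (s + t) = spiral_im s * spiral_re t + spiral_re s * spiral_im t.
Proof. by rewrite /spiral_re /spiral_im !mulrDr expRD sinD; ring. Qed.

Lemma flowx0 c x y : flowx c 0 x y = x.
Proof. by rewrite /flowx spiral_re0 spiral_im0; ring. Qed.

Lemma flowy0 c x y : flowy c 0 x y = y.
Proof. by rewrite /flowy spiral_re0 spiral_im0; ring. Qed.

Lemma flowxD c s t x y :
  flowx c (s + t) x y = flowx c s (flowx c t x y) (flowy c t x y).
Proof. by rewrite /flowx /flowy spiral_reD spiral_imD; ring. Qed.

Lemma flowyD c s t x y :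
  flowy c (s + t) x y = flowy c s (flowx c t x y) (flowy c t x y).
Proof. by rewrite /flowx /flowy spiral_reD spiral_imD; ring. Qed.

Lemma is_derive_flowx c s x y :
  is_derive s 1 (fun t => flowx c t x y)
    (l * flowx c s x y - m * flowy c s x y + c).
Proof.
rewrite /flowx; derive_by.
have N0 := sqmod_neq0; rewrite /sqmod in N0.
by rewrite /flowx /flowy /spiral_re /spiral_im /sqmod; field.
Qed.

Lemma is_derive_flowy c s x y :
  is_derive s 1 (fun t => flowy c t x y)
    (m * flowx c s x y + l * flowy c s x y).
Proof.
rewrite /flowy; derive_by.
have N0 := sqmod_neq0; rewrite /sqmod in N0.
by rewrite /flowx /flowy /spiral_re /spiral_im /sqmod; field.
Qed.

Lemma normal_formN s x y : W s (- x) (- y) = - W s x y.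
Proof. by rewrite /normal_form; ring. Qed.

Lemma normal_formZ s a x y : W s (a * x) (a * y) = a * W s x y.
Proof. by rewrite /normal_form; ring. Qed.

Lemma normal_formD s x y x' y' : W s (x + x') (y + y') = W s x y + W s x' y'.
Proof. by rewrite /normal_form; ring. Qed.

(** Multiplication by [e^(alpha s)] cancels part of the factor [e^(- alpha r)] of the form. *)
Lemma normal_form_spiral r s x y :
  W r (spiral_re s * x - spiral_im s * y) (spiral_im s * x + spiral_re s * y)
  = W (r - s) x y.
Proof.
rewrite /normal_form /spiral_re /spiral_im !mulrBr sinB cosB opprB addrC expRD.
by ring.
Qed.

Lemma normal_form_center s : W s (l / sqmod) (- (m / sqmod)) = m / sqmod - gain s.
Proof.
have N0 := sqmod_neq0.
by rewrite /normal_form /gain; field.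
Qed.

Lemma normal_form_flow r s c x y :
  W r (flowx c s x y) (flowy c s x y) =
  W (r - s) x y + c * (gain r - gain (r - s)).
Proof.
(* Split off the equilibrium [- c / alpha]: the deviation from it is turned by [e^(alpha s)], and
   the equilibrium itself is evaluated by [normal_form_center]. *)
have -> : flowx c s x y = (spiral_re s * (x + c * (l / sqmod))
    - spiral_im s * (y + c * - (m / sqmod))) + (- c) * (l / sqmod).
  by rewrite /flowx; ring.
have -> : flowy c s x y = (spiral_im s * (x + c * (l / sqmod))
    + spiral_re s * (y + c * - (m / sqmod))) + (- c) * (- (m / sqmod)).
  by rewrite /flowy; ring.
rewrite normal_formD normal_form_spiral normal_formD !normal_formZ.
by rewrite !normal_form_center; ring.
Qed.

(** Since [e^(alpha T) = - q]. Forms with index outside [[0, T]] are brought back to it in this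
    way. *)
Lemma normal_form_halfturn s x y : W (s + T) x y = - (q^-1 * W s x y).
Proof.
rewrite /normal_form !mulrDr mul_halfturn sinDpi cosDpi opprD expRD.
by rewrite [expR (- (l * T))]expRN expR_halfturn; ring.
Qed.

Lemma is_derive_gain s :
  is_derive s 1 gain (expR (- (l * s)) * sin (m * s)).
Proof.
rewrite /gain; derive_by.
have N0 := sqmod_neq0; rewrite /sqmod in N0.
by rewrite /sqmod; field.
Qed.

Lemma continuous_gain : continuous gain.
Proof. exact: continuous_is_derive is_derive_gain. Qed.

Lemma gain0 : gain 0 = 0.
Proof.
by rewrite /gain !mulr0 oppr0 expR0 cos0 sin0 mulr1 mulr0 addr0 mul1r subrr mul0r.
Qed.

Lemma gain_halfturn : gain T = m / sqmod * (1 + q^-1).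
Proof.
rewrite /gain mul_halfturn cospi sinpi expRN expR_halfturn.
by have N0 := sqmod_neq0; have q0 := lt0r_neq0 decay_gt0; field; rewrite q0 N0.
Qed.

Lemma sin_halfturn_ge0 s : 0 <= s <= T -> 0 <= sin (m * s).
Proof.
move=> /andP[s0 sT]; apply: sin_ge0_pi.
by rewrite mulr_ge0 ?(ltW m_gt0)//= -mul_halfturn ler_pM2l.
Qed.

Lemma gain_ndecr a b : 0 <= a -> a <= b -> b <= T -> gain a <= gain b.
Proof.
move=> a0 ab bT; rewrite -lerN2.
pose f' := fun s => - (expR (- (l * s)) * sin (m * s)).
apply: (@ler0_derive_nincr_off R [::] (fun s => - gain s) f') => //.
- by move=> s; apply: continuousN; exact: continuous_gain.
- by move=> s _ _; apply: is_derive_oppf; exact: is_derive_gain.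
- move=> s /andP[sa sb] _; rewrite /f' oppr_le0 mulr_ge0 ?expR_ge0//.
  by rewrite sin_halfturn_ge0 ?(ltW (le_lt_trans a0 sa)) ?(ltW (lt_le_trans sb bT)).
Qed.

Lemma gain_nincr a b : - T <= a -> a <= b -> b <= 0 -> gain b <= gain a.
Proof.
move=> aT ab b0.
pose f' := fun s => expR (- (l * s)) * sin (m * s).
apply: (@ler0_derive_nincr_off R [::] gain f') => //.
- exact: continuous_gain.
- by move=> s _ _; exact: is_derive_gain.
- move=> s /andP[sa sb] _; rewrite /f' (_ : sin (m * s) = - sin (m * (- s))); last first.
    by rewrite mulrN sinN opprK.
  rewrite mulrN oppr_le0.
  rewrite mulr_ge0 ?expR_ge0// sin_halfturn_ge0//.
  by rewrite oppr_ge0 (ltW (lt_le_trans sb b0)) lerNl (ltW (le_lt_trans aT sa)).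
Qed.

Lemma gain_ge0 s : - T <= s <= T -> 0 <= gain s.
Proof.
move=> /andP[sT Ts]; rewrite -gain0.
by have [s0|s0] := lerP 0 s; [apply: gain_ndecr|apply: gain_nincr] => //; exact: ltW.
Qed.

Hypothesis l_lt0 : l < 0.

Lemma decay_lt1 : q < 1.
Proof. by rewrite expR_lt1 pmulr_llt0 ?invr_gt0// pmulr_rlt0 ?pi_gt0. Qed.

Lemma apex_gt0 : 0 < apex.
Proof.
by rewrite divr_gt0 ?subr_gt0 ?decay_lt1// addr_gt0 ?decay_gt0.
Qed.

Lemma support0_gt0 : 0 < H 0.
Proof. by rewrite /support gain0 addr0 mulr_gt0 ?apex_gt0// divr_gt0 ?sqmod_gt0. Qed.

(** Over a half turn [|W|] is multiplied by the same factor [q^-1], so the ratio [|W| / H] agrees at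
    both ends of [[0, T]]; the value of [apex] is what makes this true. *)
Lemma support_halfturn : H T = q^-1 * H 0.
Proof.
have N0 := sqmod_neq0; have q0 := lt0r_neq0 decay_gt0.
have q1 : 1 - q != 0 by rewrite subr_eq0 gt_eqF ?decay_lt1.
rewrite /support gain0 gain_halfturn /apex; field.
by rewrite q1 N0 q0.
Qed.

Lemma support_ndecr a b : 0 <= a -> a <= b -> b <= T -> H a <= H b.
Proof. by move=> *; rewrite lerD2l gain_ndecr. Qed.

Lemma support_gt0 s : 0 <= s <= T -> 0 < H s.
Proof.
by move=> /andP[s0 sT]; rewrite (lt_le_trans support0_gt0)// support_ndecr.
Qed.

Lemma continuous_support : continuous H.
Proof.
move=> s; rewrite /support.
by apply: cvgD; [exact: cvg_cst|exact: continuous_gain].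
Qed.

End SpiralFunctionals.

(** * The gauge norm *)

Section Gauge.
Context {R : realType}.
Variables l m : R.
Hypotheses (m_gt0 : 0 < m) (l_lt0 : l < 0).
Implicit Types r s t x y : R.

Local Notation T := (halfturn m).
Local Notation q := (decay l m).
Local Notation W := (normal_form l m).
Local Notation H := (support l m).

Definition gauge x y : R :=
  sup [set w | exists2 s, 0 <= s <= T & w = `|W s x y| / H s].

Local Notation F := gauge.

Lemma is_derive_normal_form s x y :
  is_derive s 1 (fun t => W t x y)
    (expR (- (l * s)) * ((m * cos (m * s) - l * sin (m * s)) * x
                       + (m * sin (m * s) + l * cos (m * s)) * y)).
Proof. by rewrite /normal_form; derive_by; ring. Qed.

Lemma is_derive_normal_form_along s c (X Y : R -> R) u :
  is_derive s 1 X (l * X s - m * Y s + u) ->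
  is_derive s 1 Y (m * X s + l * Y s) ->
  is_derive s 1 (fun t => W (t - c) (X t) (Y t))
    (expR (- (l * (s - c))) * sin (m * (s - c)) * u).
Proof. by move=> dX dY; rewrite /normal_form; derive_by; ring. Qed.

Lemma continuous_normal_form c (X Y : R -> R) : continuous X -> continuous Y ->
  continuous (fun t => W (t - c) (X t) (Y t)).
Proof.
move=> cX cY s.
have dS (g g' : R -> R) : (forall t, is_derive t 1 g (g' t)) ->
    {for s, continuous g} by move=> dg; exact: (continuous_is_derive dg).
rewrite /normal_form; apply: cvgM.
  by apply: dS => t; derive_by; reflexivity.
apply: cvgB; apply: cvgM; [|exact: cX| |exact: cY];
by apply: dS => t; derive_by; reflexivity.
Qed.

Let cratio x y s : 0 <= s <= T -> {for s, continuous (fun s => `|W s x y| / H s)}.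
Proof.
move=> sT; apply: cvgM.
  apply: cvg_norm.
  exact: (continuous_is_derive (fun t => is_derive_normal_form t x y)).
apply: cvgV; first exact: lt0r_neq0 (support_gt0 m_gt0 l_lt0 sT).
exact: continuous_support.
Qed.

(** A continuous function on a compact interval attains its supremum; hence strict bounds on each
    form give a strict bound on the gauge. *)
Lemma gauge_attained x y :
  exists2 s, 0 <= s <= T & `|W s x y| = F x y * H s.
Proof.
have T0 : 0 <= T := ltW (halfturn_gt0 m_gt0).
have cf : {within `[0, T], continuous (fun s => `|W s x y| / H s)}.
  apply: continuous_in_subspaceT => s; rewrite inE /= in_itv /=.
  exact: cratio.
have [s sT smax] := EVT_max T0 cf; rewrite in_itv /= in sT.
exists s => //; suff -> : F x y = `|W s x y| / H s.
  by rewrite divfK// lt0r_neq0// support_gt0.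
apply/eqP; rewrite eq_le; apply/andP; split.
  apply: ge_sup; first by exists (`|W s x y| / H s), s.
  by move=> _ [t tT ->]; apply: smax; rewrite in_itv.
apply: ub_le_sup; last by exists s.
exists (`|W s x y| / H s) => _ [t tT ->].
by apply: smax; rewrite in_itv.
Qed.

Lemma gauge_ub s x y : 0 <= s <= T -> `|W s x y| <= F x y * H s.
Proof.
move=> sT; rewrite -ler_pdivrMr ?support_gt0//.
have T0 : 0 <= T := ltW (halfturn_gt0 m_gt0).
apply: ub_le_sup; last by exists s.
have [M hM] : exists M, forall t, 0 <= t <= T -> `|W t x y| / H t <= M.
  have cf : {within `[0, T], continuous (fun s => `|W s x y| / H s)}.
    apply: continuous_in_subspaceT => t; rewrite inE /= in_itv /=.
    exact: cratio.
  have [c _ cmax] := EVT_max T0 cf.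
  by exists (`|W c x y| / H c) => t tT; apply: cmax; rewrite in_itv.
by exists M => _ [t tT ->]; exact: hM.
Qed.

Lemma gauge_le k x y :
  (forall s, 0 <= s <= T -> `|W s x y| <= k * H s) -> F x y <= k.
Proof.
move=> h; have [s sT e] := gauge_attained x y.
by rewrite -(ler_pM2r (support_gt0 m_gt0 l_lt0 sT)) -e h.
Qed.

Lemma gauge_lt k x y :
  (forall s, 0 <= s <= T -> `|W s x y| < k * H s) -> F x y < k.
Proof.
move=> h; have [s sT e] := gauge_attained x y.
by rewrite -(ltr_pM2r (support_gt0 m_gt0 l_lt0 sT)) -e h.
Qed.

Lemma gauge_ge0 x y : 0 <= F x y.
Proof.
have [s sT e] := gauge_attained x y.
by rewrite -(ler_pM2r (support_gt0 m_gt0 l_lt0 sT)) -e mul0r.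
Qed.

Lemma gaugeZ a x y : F (a * x) (a * y) = `|a| * F x y.
Proof.
apply/eqP; rewrite eq_le; apply/andP; split.
  apply: gauge_le => s sT; rewrite normal_formZ normrM -mulrA.
  by rewrite ler_wpM2l// gauge_ub.
have [s sT e] := gauge_attained x y.
have Hs := support_gt0 m_gt0 l_lt0 sT.
by rewrite -(ler_pM2r Hs) -mulrA -e -normrM -normal_formZ gauge_ub.
Qed.

Lemma gaugeN x y : F (- x) (- y) = F x y.
Proof. by rewrite -mulN1r -[- y]mulN1r gaugeZ normrN1 mul1r. Qed.

Lemma gaugeD x y x' y' : F (x + x') (y + y') <= F x y + F x' y'.
Proof.
apply: gauge_le => s sT; rewrite normal_formD mulrDl.
by rewrite (le_trans (ler_normD _ _))// lerD// gauge_ub.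
Qed.

Lemma gauge00 : F 0 0 = 0.
Proof. by have := gaugeZ 0 0 0; rewrite !mul0r normr0 mul0r. Qed.

Lemma gauge_bound x y : F x y <= `|x| * F 1 0 + `|y| * F 0 1.
Proof.
rewrite -!gaugeZ !mulr1 !mulr0 -{1}[x]addr0 -{1}[y]add0r.
exact: gaugeD.
Qed.

Lemma gauge_dist x y x' y' : `|F x y - F x' y'| <= F (x - x') (y - y').
Proof.
have sub a b c d : F a b - F c d <= F (a - c) (b - d).
  by rewrite lerBlDr -{1}[a](subrK c) -{1}[b](subrK d) gaugeD.
rewrite ler_norml sub andbT lerNl -[F (x - x') _]gaugeN.
rewrite (opprB (F x y)) (opprB x) (opprB y).
exact: sub.
Qed.

Lemma continuous_gauge (S : topologicalType) (X Y : S -> R) (a : S) :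
  {for a, continuous X} -> {for a, continuous Y} ->
  {for a, continuous (fun v => F (X v) (Y v))}.
Proof.
move=> cX cY; apply/cvgrPdist_lt => e e0.
(* The gauge is Lipschitz in the larger coordinate difference with constant [F 1 0 + F 0 1]; the
   added 1 makes [K] positive and the last inequality strict. *)
pose K := F 1 0 + F 0 1 + 1.
have K0 : 0 < K by rewrite ltr_wpDl// addr_ge0// gauge_ge0.
have eK : 0 < e / K by rewrite divr_gt0.
have /cvgrPdist_lt/(_ _ eK) hX := cX; have /cvgrPdist_lt/(_ _ eK) hY := cY.
near=> v.
apply: (le_lt_trans (gauge_dist _ _ _ _)).
apply: (le_lt_trans (gauge_bound _ _)).
apply: (@le_lt_trans _ _ (e / K * (F 1 0 + F 0 1))).
  rewrite mulrDr lerD// ler_wpM2r ?gauge_ge0// ltW//; near: v; [exact: hX|exact: hY].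
rewrite mulrAC ltr_pdivrMr// ltr_pM2l// /K ltrDl//.
Unshelve. all: by end_near. Qed.

(** At the indices 0 and [T / 2] the form reads off [- y] and a positive multiple of [x], so the
    gauge controls both coordinates. *)
Lemma gauge_coord : exists2 K, 0 < K &
  forall x y, `|x| <= K * F x y /\ `|y| <= K * F x y.
Proof.
have T0 : 0 < T := halfturn_gt0 m_gt0.
have h0 : 0 <= (0 : R) <= T by rewrite lexx ltW.
have h2 : 0 <= T / 2 <= T by apply/andP; split; lra.
have mT2 : m * (T / 2) = pi / 2 by rewrite mulrA mul_halfturn.
have H0 := support_gt0 m_gt0 l_lt0 h0; have H2 := support_gt0 m_gt0 l_lt0 h2.
pose k := expR (l * (T / 2)) * H (T / 2).
exists (H 0 + k) => [|x y]; first by rewrite addr_gt0// mulr_gt0 ?expR_gt0.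
have Fp := gauge_ge0 x y.
have k0 : 0 < k by rewrite mulr_gt0 ?expR_gt0.
have := gauge_ub x y h0; have := gauge_ub x y h2.
rewrite /normal_form mT2 sin_pihalf cos_pihalf !mulr0 oppr0 expR0 sin0 cos0.
rewrite !mul0r !mul1r subr0 sub0r normrN => hx hy; split; last first.
  by rewrite (le_trans hy)// mulrC ler_wpM2r// lerDl ltW.
have : `|x| <= k * F x y.
  rewrite normrM ger0_norm ?expR_ge0// expRN mulrC ler_pdivrMr ?expR_gt0// in hx.
  by rewrite /k -mulrA mulrC [H _ * _]mulrC.
by move=> hx'; rewrite (le_trans hx')// ler_wpM2r// lerDr ltW.
Qed.

Lemma gauge_eq0 x y : F x y = 0 -> x = 0 /\ y = 0.
Proof.
have [K _ hK] := gauge_coord; have [] := hK x y.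
by move=> hx hy F0; move: hx hy; rewrite F0 mulr0 !normr_le0 => /eqP + /eqP.
Qed.

Lemma gauge_gt0 x y : (x != 0) || (y != 0) -> 0 < F x y.
Proof.
move=> h; rewrite lt_neqAle gauge_ge0 andbT eq_sym; apply/eqP => /gauge_eq0[x0 y0].
by move: h; rewrite x0 y0 eqxx.
Qed.

End Gauge.

(** * Forward invariance of the unit balls of the gauge *)

Section Invariance.
Context {R : realType}.
Variables l m : R.
Hypotheses (m_gt0 : 0 < m) (l_lt0 : l < 0).
Variables (X Y u : R -> R) (D : set R).
Hypotheses (cX : continuous X) (cY : continuous Y).
Hypothesis finD : forall a b : R, finite_set (D `&` `[a, b]).
Hypothesis u_le1 : forall s, `|u s| <= 1.
Hypothesis dX : forall s, ~ D s -> is_derive s 1 X (l * X s - m * Y s + u s).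
Hypothesis dY : forall s, ~ D s -> is_derive s 1 Y (m * X s + l * Y s).

Local Notation T := (halfturn m).
Local Notation q := (decay l m).
Local Notation W := (normal_form l m).
Local Notation H := (support l m).
Local Notation F := (gauge l m).

(* The normal rotates with the flow, so only the control contributes to the
   derivative of [W], and by at most the derivative of [H]. *)
Let is_derive_support_shift (c s : R) : is_derive s 1 (fun s => H (s - c))
  (expR (- (l * (s - c))) * sin (m * (s - c))).
Proof.
have N0 := sqmod_neq0 l m_gt0; rewrite /sqmod in N0.
by rewrite /support /gain; derive_by; rewrite /sqmod; field.
Qed.

Lemma excess_nincr t0 r t : 0 <= r -> 0 <= t -> r + t <= T ->
  `|W (r + t) (X (t0 + t)) (Y (t0 + t))| - H (r + t) <=
  `|W r (X t0) (Y t0)| - H r.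
Proof.
move=> r0 t_ge0 rtT.
(* With the sign taken at the final time, [f] equals [|W| - H] there and is at most [|W| - H] at the
   initial time. *)
pose e : R := (-1) ^+ (W (r + t) (X (t0 + t)) (Y (t0 + t)) < 0)%R.
have e1 : `|e| = 1 by rewrite normr_sign.
pose f s := e * W (s - (t0 - r)) (X s) (Y s) - H (s - (t0 - r)).
have E : f (t0 + t) <= f t0.
  (* Only finitely many exceptional times lie between the two ends. *)
  have /finite_seqP[L hL] := finD t0 (t0 + t).
  have offD s : t0 < s < t0 + t -> s \notin L -> ~ D s.
    move=> /andP[s0 s1] sL Ds; move: sL; have : (D `&` `[t0, t0 + t]) s.
      by split=> //=; rewrite in_itv /= (ltW s0) (ltW s1).
    by rewrite hL /= => ->.
  pose k s := expR (- (l * (s - (t0 - r)))) * sin (m * (s - (t0 - r))).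
  apply: (@ler0_derive_nincr_off _ L f (fun s => k s * (e * u s - 1))).
  - move=> s; apply: cvgB.
      by apply: cvgMl_tmp; exact: continuous_normal_form.
    exact: (continuous_is_derive (is_derive_support_shift _)).
  - move=> s sab sL; have Ds := offD s sab sL.
    have dW := is_derive_normal_form_along (t0 - r) (dX Ds) (dY Ds).
    have dH := is_derive_support_shift (t0 - r) s.
    by rewrite /f; derive_by; rewrite /k; ring.
  - move=> s /andP[s0 s1] sL; rewrite mulr_ge0_le0//.
      rewrite mulr_ge0 ?expR_ge0// sin_halfturn_ge0//.
      by apply/andP; split; lra.
    rewrite subr_le0 (le_trans (ler_norm _))// normrM e1 mul1r.
    exact: u_le1.
  - by rewrite lerDl.
rewrite /f in E.
have E1 : t0 + t - (t0 - r) = r + t by ring.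
have E2 : t0 - (t0 - r) = r by ring.
rewrite E1 E2 {1}/e -normrEsign ?num_real// in E.
apply: (le_trans E); rewrite lerD2r.
by rewrite (le_trans (ler_norm _))// normrM e1 mul1r.
Qed.

(* For a time step [t > s] the normal passes through the angle 0, where the form
   reappears with the opposite sign at the end of the half turn. *)
Lemma excess_step t0 t s : 0 <= t <= T -> 0 <= s <= T ->
  exists r c, [/\ 0 <= r <= T, 0 < c &
    `|W s (X (t0 + t)) (Y (t0 + t))| - H s <=
    c * (`|W r (X t0) (Y t0)| - H r)].
Proof.
move=> /andP[t_ge0 tT] /andP[s0 sT]; have [ts|st] := lerP t s.
  exists (s - t), 1; split=> //; first by apply/andP; split; lra.
  have r0 : 0 <= s - t by lra.
  have rT : s - t + t <= T by lra.
  by have := excess_nincr t0 r0 t_ge0 rT; rewrite subrK mul1r.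
have q0 := decay_gt0 l m.
have r0 : 0 <= T - (t - s) by lra.
have h1 : 0 <= t - s by lra.
have rT : T - (t - s) + (t - s) <= T by lra.
exists (T - (t - s)), q; split=> //; first by apply/andP; split; lra.
have s1 : 0 + s <= T by lra.
have h2 := excess_nincr t0 r0 h1 rT.
have h3 := excess_nincr (t0 + (t - s)) (lexx 0) s0 s1.
rewrite add0r -addrA subrK in h3.
rewrite -(ler_pM2l q0) in h2; apply: (le_trans h3); apply: (le_trans _ h2).
rewrite subrK support_halfturn// -{1}[T]add0r normal_form_halfturn//.
rewrite normrN (normrM q^-1) (ger0_norm (x := q^-1)) ?invr_ge0 ?(ltW q0)//.
by rewrite mulrBr !mulrA mulfV ?gt_eqF// !mul1r.
Qed.

(** [excess_step] covers time steps up to a half turn; a longer interval is cut into equal steps of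
    at most that length. *)
Let forward (P : R -> Prop) :
  (forall t0 t, 0 <= t <= T -> P t0 -> P (t0 + t)) ->
  forall t0 t1, t0 <= t1 -> P t0 -> P t1.
Proof.
move=> step t0 t1 t01 P0.
have T0 := halfturn_gt0 m_gt0.
pose n := Num.bound ((t1 - t0) / T).
have hn : (t1 - t0) / T < n%:R.
  by apply: archi_boundP; rewrite divr_ge0 ?(ltW T0)// subr_ge0.
have n0 : 0 < n%:R :> R.
  by rewrite (le_lt_trans _ hn)// divr_ge0 ?(ltW T0)// subr_ge0.
pose tau := (t1 - t0) / n%:R.
have tauT : 0 <= tau <= T.
  apply/andP; split; first by rewrite divr_ge0 ?(ltW n0)// subr_ge0.
  by rewrite ler_pdivrMr// -ler_pdivrMl// mulrC ltW.
have Pk k : P (t0 + tau * k%:R).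
  elim: k => [|k IHk]; first by rewrite mulr0 addr0.
  by rewrite -natr1 mulrDr mulr1 addrA; exact: step.
by have := Pk n; rewrite divfK ?gt_eqF// addrC subrK.
Qed.

Lemma gauge_lt1_forward t0 t1 : t0 <= t1 ->
  F (X t0) (Y t0) < 1 -> F (X t1) (Y t1) < 1.
Proof.
move: t0 t1; apply: forward => t0 t tT F1.
apply: gauge_lt => // s sT; rewrite mul1r -subr_lt0.
have [r [c [rT c0 hr]]] := excess_step t0 tT sT.
apply: (le_lt_trans hr); rewrite pmulr_rlt0// subr_lt0.
apply: (le_lt_trans (gauge_ub m_gt0 l_lt0 _ _ rT)).
by rewrite gtr_pMl// support_gt0.
Qed.

Lemma gauge_le1_forward t0 t1 : t0 <= t1 ->
  F (X t0) (Y t0) <= 1 -> F (X t1) (Y t1) <= 1.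
Proof.
move: t0 t1; apply: forward => t0 t tT F1.
apply: gauge_le => // s sT; rewrite mul1r -subr_le0.
have [r [c [rT c0 hr]]] := excess_step t0 tT sT.
apply: (le_trans hr); rewrite pmulr_rle0// subr_le0.
apply: (le_trans (gauge_ub m_gt0 l_lt0 _ _ rT)).
by rewrite ger_pMl// support_gt0.
Qed.

End Invariance.

(** * The unit sphere of the gauge and the arcs of the orbit *)

Section Orbit.
Context {R : realType}.
Variables l m : R.
Hypotheses (m_gt0 : 0 < m) (l_lt0 : l < 0).
Implicit Types r s t x y : R.

Local Notation T := (halfturn m).
Local Notation q := (decay l m).
Local Notation p := (apex l m).
Local Notation W := (normal_form l m).
Local Notation H := (support l m).
Local Notation F := (gauge l m).
Local Notation N := (sqmod l m).

(** The arc of the control 1 that starts at [p / alpha]; the other arc of the orbit is its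
    opposite. *)
Definition orbitx s : R := flowx l m 1 s (p * (l / N)) (p * - (m / N)).
Definition orbity s : R := flowy l m 1 s (p * (l / N)) (p * - (m / N)).

(** At [r = s] the form takes the value [H s], and for other indices within a half turn the
    nonnegative [gain] lowers it: [H] is the support function of the arc. *)
Lemma normal_form_orbit r s :
  W r (orbitx s) (orbity s) = H r - (1 + p) * gain l m (r - s).
Proof.
by rewrite normal_form_flow// normal_formZ normal_form_center// /support; ring.
Qed.

Let N0 : 0 < N := sqmod_gt0 l m_gt0.
Let q0 : 0 < q := decay_gt0 l m.
Let q1 : 0 < 1 - q. Proof. by rewrite subr_gt0 decay_lt1. Qed.

(** The difference of the two sides is [(p - 1) (gain T - gain t)]. This bound and the next one give
    [- H r <= W r] along the arc, for [s <= r] and for [r < s] respectively. *)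
Let gain_le_support t : 0 <= t -> t <= T -> (1 + p) * gain l m t <= 2 * H t.
Proof.
move=> t0 tT; have T0 := halfturn_gt0 m_gt0.
rewrite /support -subr_ge0.
have -> : 2 * (p * (m / N) + gain l m t) - (1 + p) * gain l m t =
    2 * (p * (m / N)) - (p - 1) * gain l m t by ring.
have p1 : p - 1 = 2 * q / (1 - q) by rewrite /apex; field; rewrite gt_eqF.
have p10 : 0 <= p - 1 by rewrite p1 divr_ge0 ?mulr_ge0 ?(ltW q0) ?(ltW q1).
have -> : 2 * (p * (m / N)) = (p - 1) * gain l m T.
  rewrite p1 gain_halfturn// /apex; field.
  by rewrite !gt_eqF.
by rewrite -mulrBr mulr_ge0// subr_ge0 gain_ndecr.
Qed.

(** [gain] decreases on [[- T, 0]], and at [- T] the bound is an equality. *)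
Let gain_le_support0 t : 0 <= t -> t <= T -> (1 + p) * gain l m (- t) <= 2 * H 0.
Proof.
move=> t0 tT; have T0 := halfturn_gt0 m_gt0.
have -> : 2 * H 0 = (1 + p) * gain l m (- T).
  rewrite /support gain0 addr0 /gain !mulrN opprK mul_halfturn// sinN cosN.
  rewrite cospi sinpi expR_halfturn /apex; field.
  by rewrite !gt_eqF.
have pp : 0 < 1 + p by rewrite addr_gt0// apex_gt0.
by rewrite ler_pM2l// gain_nincr// ?lerN2// oppr_le0.
Qed.

(** The form of index [s] already has ratio 1 at the point of parameter [s], and every other form
    stays between [- H r] and [H r]. *)
Lemma gauge_orbit s : 0 <= s <= T -> F (orbitx s) (orbity s) = 1.
Proof.
move=> /andP[s0 sT]; have T0 := halfturn_gt0 m_gt0.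
apply/eqP; rewrite eq_le; apply/andP; split; last first.
  have s1 : 0 <= s <= T by rewrite s0.
  have := gauge_ub m_gt0 l_lt0 (orbitx s) (orbity s) s1.
  have Hs := support_gt0 m_gt0 l_lt0 s1.
  rewrite normal_form_orbit subrr gain0 mulr0 subr0 ger0_norm ?(ltW Hs)//.
  by rewrite -{1}[H s]mul1r ler_pM2r.
apply: gauge_le => // r /andP[r0 rT]; rewrite mul1r normal_form_orbit.
have pp : 0 < 1 + p by rewrite addr_gt0// apex_gt0.
rewrite ler_norml; apply/andP; split; last first.
  by rewrite gerBl mulr_ge0 ?(ltW pp)// gain_ge0//; apply/andP; split; lra.
suff : (1 + p) * gain l m (r - s) <= 2 * H r by lra.
have [sr|rs] := lerP s r.
  have a0 : 0 <= r - s by lra.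
  have a1 : r - s <= T by lra.
  apply: (le_trans (gain_le_support a0 a1)).
  by rewrite ler_pM2l// support_ndecr//; lra.
have a0 : 0 <= s - r by lra.
have a1 : s - r <= T by lra.
have := gain_le_support0 a0 a1; rewrite opprB => /le_trans; apply.
by rewrite ler_pM2l// support_ndecr.
Qed.

(* At a point of contact with its supporting line the nonnegative function
   [r |-> H r - W r x y] has a minimum, and its derivative gives the second
   linear equation for [(x, y)]. *)
Lemma support_contact s x y : 0 <= s < T -> F x y <= 1 -> W s x y = H s ->
  x = orbitx s /\ y = orbity s.
Proof.
move=> /andP[s0 sT] F1 eW; have T0 := halfturn_gt0 m_gt0.
have W_le_H r : 0 <= r <= T -> `|W r x y| <= H r.
  move=> rT; apply: (le_trans (gauge_ub m_gt0 l_lt0 _ _ rT)).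
  by rewrite ger_pMl// support_gt0.
pose g r := H r - W r x y.
(* Negative indices are shifted by a half turn, so that the contact index 0 is also interior to the
   interval and the derivative vanishes there. *)
have g_ge0 r : r \in `](- T), T[ -> 0 <= g r.
  rewrite in_itv /= subr_ge0 => /andP[rl rr]; have [r0|r0] := lerP 0 r.
    by rewrite (le_trans (ler_norm _))// W_le_H// r0 ltW.
  have rT : 0 <= r + T <= T by apply/andP; split; lra.
  have -> : W r x y = - (q * W (r + T) x y).
    by rewrite normal_form_halfturn// mulrN opprK mulrA mulfV ?gt_eqF// mul1r.
  apply: (@le_trans _ _ (q * H (r + T))).
    rewrite -mulrN ler_pM2l//; apply: le_trans (W_le_H _ rT).
    by rewrite -normrN ler_norm.
  apply: (@le_trans _ _ (H 0)).
    rewrite (_ : H 0 = q * H T) ?ler_pM2l//.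
      by case/andP: rT => ? ?; rewrite support_ndecr.
    by rewrite support_halfturn// mulrA mulfV ?gt_eqF// mul1r.
  by rewrite lerD2l gain_nincr// ltW.
have dg r : is_derive r 1 g (expR (- (l * r)) * sin (m * r) -
    expR (- (l * r)) * ((m * cos (m * r) - l * sin (m * r)) * x
                       + (m * sin (m * r) + l * cos (m * r)) * y)).
  have d1 := is_derive_gain l m_gt0 r; have d2 := is_derive_normal_form l m r x y.
  by rewrite /g /support; derive_by; ring.
have sI : s \in `](- T), T[ by rewrite in_itv /=; apply/andP; split; lra.
have TT : - T <= T by lra.
have [_ dgs] : is_derive s 1 g 0.
  apply: (derive1_at_min TT _ sI) => [t _|t tI]; first by case: (dg t).
  by rewrite {1}/g eW subrr g_ge0.
case: (dg s) => _; rewrite dgs => /esym/eqP; rewrite -mulrBr mulf_eq0.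
rewrite gt_eqF ?expR_gt0//= => /eqP eq1.
move: eW; rewrite /normal_form /support /gain => eq2.
have e0 : expR (- (l * s)) = (expR (l * s))^-1 by rewrite expRN.
have E0 : expR (l * s) != 0 by rewrite gt_eqF ?expR_gt0.
have cs := cos2Dsin2 (m * s).
rewrite /orbitx /orbity /flowx /flowy /spiral_re /spiral_im.
move: e0 E0 cs eq1 eq2; move: (expR (- (l * s))) (expR (l * s)) => e' E e0 E0.
move: (cos _) (sin _) => c d cs eq1 eq2.
(* The contact and derivative equations determine [d x - c y] and [c x + d y], up to sign the
   coordinates of the point in the frame turned by the angle [m s]; turning back gives [x] and
   [y]. *)
have eqQ : d * x - c * y = E * (1 + p) * (m / N) - (m * c + l * d) / N.
  have h : d * x - c * y = E * (e' * (d * x - c * y)).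
    by rewrite mulrA e0 mulfV// mul1r.
  rewrite h eq2 e0; field.
  by rewrite gt_eqF// E0.
have eqP' : c * x + d * y = (d + l * (d * x - c * y)) / m.
  have m0 : m != 0 by rewrite gt_eqF.
  apply: (mulfI m0); rewrite mulrC [RHS]mulrC divfK//; lra.
have m0 : m != 0 by rewrite gt_eqF.
have Nn0 : N != 0 by rewrite gt_eqF.
split.
  transitivity ((c ^+ 2 + d ^+ 2) * x); first by rewrite cs mul1r.
  transitivity (c * (c * x + d * y) + d * (d * x - c * y)); first by ring.
  rewrite eqP' eqQ.
  transitivity (E * (1 + p) * (l * c + m * d) / N - l / N * (c ^+ 2 + d ^+ 2)).
    by move: Nn0; rewrite /sqmod => Nn0; field; rewrite Nn0.
  by rewrite cs; field.
transitivity ((c ^+ 2 + d ^+ 2) * y); first by rewrite cs mul1r.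
transitivity (d * (c * x + d * y) - c * (d * x - c * y)); first by ring.
rewrite eqP' eqQ.
transitivity (E * (1 + p) * (l * d - m * c) / N + m / N * (c ^+ 2 + d ^+ 2)).
  by move: Nn0; rewrite /sqmod => Nn0; field; rewrite Nn0.
by rewrite cs; field.
Qed.

Lemma gauge_eq1_orbit x y : F x y = 1 -> exists2 s, 0 <= s <= T &
  (x = orbitx s /\ y = orbity s) \/ (x = - orbitx s /\ y = - orbity s).
Proof.
move=> F1; have T0 := halfturn_gt0 m_gt0.
have [s sT] := gauge_attained m_gt0 l_lt0 x y; rewrite F1 mul1r => e.
have contact r : 0 <= r < T -> `|W r x y| = H r -> exists2 s, 0 <= s <= T &
  (x = orbitx s /\ y = orbity s) \/ (x = - orbitx s /\ y = - orbity s).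
  move=> /andP[r0 rT]; have rT' : 0 <= r < T by rewrite r0.
  have F1' : F x y <= 1 by rewrite F1.
  move=> eW; exists r; first by rewrite r0 ltW.
  have [W0|W0] := lerP 0 (W r x y).
    by left; apply: support_contact => //; rewrite -eW ger0_norm.
  right; have [||<- <-] := @support_contact r (- x) (- y) rT'.
  - by rewrite gaugeN.
  - by rewrite normal_formN -eW ltr0_norm.
  - by rewrite !opprK.
have /andP[s0] := sT; rewrite le_eqVlt => /orP[/eqP sT'|sT']; last first.
  by apply: contact e; rewrite s0.
(* The index [T] carries the same equation as the index 0, with both sides multiplied by [q^-1]. *)
apply: (contact 0); first by rewrite lexx.
move: e; rewrite sT' support_halfturn// -{1}[T]add0r normal_form_halfturn//.
rewrite normrN (normrM q^-1) (ger0_norm (x := q^-1)) ?invr_ge0 ?(ltW q0)//.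
move=> /mulfI; apply.
by rewrite invr_eq0 gt_eqF.
Qed.

End Orbit.

(** * Linear coordinates *)

Section TwoByTwo.
Variable F : comNzRingType.

Lemma sum_ord2 (f : 'I_2 -> F) : \sum_i f i = f 0 + f 1.
Proof. by rewrite 2!big_ord_recl big_ord0 addr0; congr (_ + f _); exact/val_inj. Qed.

Lemma ord2P (i : 'I_2) : i = 0 \/ i = 1.
Proof. by case: i => [[|[|//]]] hi; [left|right]; exact/val_inj. Qed.

Lemma mulmx2E (A : 'M[F]_2) (v : 'cV[F]_2) i :
  (A *m v) i 0 = A i 0 * v 0 0 + A i 1 * v 1 0.
Proof. by rewrite mxE sum_ord2. Qed.

Lemma det_mx2 (A : 'M[F]_2) : \det A = A 0 0 * A 1 1 - A 0 1 * A 1 0.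
Proof.
rewrite (expand_det_row _ 0) sum_ord2 /cofactor !det_mx11 !mxE /=.
rewrite (_ : lift 0 0 = 1); last exact/val_inj.
rewrite (_ : lift 1 0 = 0); last exact/val_inj.
by ring.
Qed.

Lemma cV2P (v w : 'cV[F]_2) : v 0 0 = w 0 0 -> v 1 0 = w 1 0 -> v = w.
Proof.
move=> h0 h1; apply/matrixP => i j; rewrite (ord1 j).
by have [->|->] := ord2P i.
Qed.

End TwoByTwo.

(** The imaginary part of the characteristic equation at [l + i m] is [m (2 l - tr A) = 0]; the real
    part then gives the determinant. *)
Lemma complex_eigenvalues_tr_det (R : realType) (A : 'M[R]_2) (l m : R) :
  0 < m -> complex_eigenvalues A l m ->
  \tr A = 2 * l /\ \det A = l ^+ 2 + m ^+ 2.
Proof.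
move=> m0 [+ _]; rewrite eigenvalue_root_char => /rootP.
set B := map_mx _ A; have trB : \tr B = (\tr A)%:C%C.
  by rewrite trace_map_mx.
have detB : \det B = (\det A)%:C%C by rewrite det_map_mx.
have /monicP := char_poly_monic B; rewrite /lead_coef size_char_poly /= => c2.
have c1 := @char_poly_trace _ 2 B isT; rewrite /= in c1.
have c0 := char_poly_det B.
rewrite horner_coef size_char_poly !big_ord_recl big_ord0 /= /bump /=.
rewrite c0 c1 c2 trB detB !exprS !expr0 => /eqP.
rewrite eq_complex /= => /andP[/eqP re /eqP im].
have mn0 : m != 0 by rewrite gt_eqF.
have tr2 : \tr A = 2 * l by apply: (mulIf mn0); lra.
by split=> //; rewrite tr2 in re; lra.
Qed.

Section MatrixCalculus.
Context {R : realType}.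

Lemma is_derive_mxP n k (M : R -> 'M[R]_(n, k)) (D : 'M[R]_(n, k)) (s : R) :
  is_derive s 1 M D <-> forall i j, is_derive s 1 (fun t => M t i j) (D i j).
Proof.
split=> [[dM eM] i j|dM].
  have /derivable_mxP dMij := dM.
  by apply: DeriveDef => //; rewrite -eM derive_mx// mxE.
have dM' : derivable M s 1 by apply/derivable_mxP => i j; case: (dM i j).
apply: DeriveDef => //; rewrite derive_mx//; apply/matrixP => i j; rewrite mxE.
by case: (dM i j).
Qed.

End MatrixCalculus.

Section SpiralCoordinates.
Context {R : realType}.
Variables (A : 'M[R]_2) (eta : 'cV[R]_2) (l m um up : R).
Implicit Types (v w : 'cV[R]_2) (x y s t c : R).

Definition control_mid : R := (um + up) / 2.
Definition control_rad : R := (up - um) / 2.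
Definition normalized c : R := (c - control_mid) / control_rad.

(* In the basis [axis1], [axis2] centred at the equilibrium of the mean control
   the matrix is [[l, -m], [m, l]] and the control acts on the first axis. *)
Definition axis1 : 'cV[R]_2 := control_rad *: eta.
Definition axis2 : 'cV[R]_2 := m^-1 *: (A *m axis1 - l *: axis1).
Definition center : 'cV[R]_2 := - control_mid *: (invmx A *m eta).
Definition axes_det : R := axis1 0 0 * axis2 1 0 - axis1 1 0 * axis2 0 0.
Definition coordx v : R :=
  ((v 0 0 - center 0 0) * axis2 1 0 - (v 1 0 - center 1 0) * axis2 0 0) / axes_det.
Definition coordy v : R :=
  (axis1 0 0 * (v 1 0 - center 1 0) - axis1 1 0 * (v 0 0 - center 0 0)) / axes_det.
Definition of_coord x y : 'cV[R]_2 := center + x *: axis1 + y *: axis2.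
Definition flow c t v : 'cV[R]_2 :=
  of_coord (flowx l m (normalized c) t (coordx v) (coordy v))
           (flowy l m (normalized c) t (coordx v) (coordy v)).

Hypotheses (m_gt0 : 0 < m) (um_lt_up : um < up) (eta_neq0 : eta != 0).
Hypotheses (trA : \tr A = 2 * l) (detA : \det A = l ^+ 2 + m ^+ 2).

Let m0 : m != 0. Proof. exact: lt0r_neq0. Qed.

Lemma control_rad_gt0 : 0 < control_rad.
Proof. by rewrite divr_gt0// subr_gt0. Qed.

Let k0 : control_rad != 0. Proof. exact: lt0r_neq0 control_rad_gt0. Qed.

Let trA' : A 0 0 + A 1 1 = 2 * l. Proof. by rewrite -trA /mxtrace sum_ord2. Qed.
Let detA' : A 0 0 * A 1 1 - A 0 1 * A 1 0 = l ^+ 2 + m ^+ 2.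
Proof. by rewrite -detA det_mx2. Qed.

Lemma axes_detE : axes_det = control_rad ^+ 2 / m *
  (A 1 0 * eta 0 0 ^+ 2 + (A 1 1 - A 0 0) * eta 0 0 * eta 1 0
   - A 0 1 * eta 1 0 ^+ 2).
Proof.
rewrite /axes_det /axis2 /axis1 !mxE !sum_ord2 !mxE.
by field.
Qed.

(** The bracket in [axes_detE] is [det (eta, A eta)], a quadratic form in [eta] of discriminant
    [(tr A)^2 - 4 det A = - 4 m^2 < 0]; completing the square shows that it vanishes only at 0. *)
Lemma axes_det_neq0 : axes_det != 0.
Proof.
rewrite axes_detE; apply: mulf_neq0.
  by apply: mulf_neq0; [exact: expf_neq0|rewrite invr_eq0].
apply: contra_neq eta_neq0 => form0.
have a0 : A 0 0 = 2 * l - A 1 1 by rewrite -trA' addrK.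
have sq : (2 * A 1 0 * eta 0 0 + (A 1 1 - A 0 0) * eta 1 0) ^+ 2
    + (2 * m * eta 1 0) ^+ 2 = 0.
  transitivity (4 * A 1 0 * (A 1 0 * eta 0 0 ^+ 2
    + (A 1 1 - A 0 0) * eta 0 0 * eta 1 0 - A 0 1 * eta 1 0 ^+ 2)
    + ((A 0 0 + A 1 1) ^+ 2 - 4 * (A 0 0 * A 1 1 - A 0 1 * A 1 0) + 4 * m ^+ 2)
      * eta 1 0 ^+ 2); first by ring.
  by rewrite form0 trA' detA'; ring.
have /eqP := sq; rewrite paddr_eq0 ?sqr_ge0// !expf_eq0 /= => /andP[h1 h2].
have f0 : eta 1 0 = 0.
  by apply/eqP; move: h2; rewrite !mulf_eq0 (negPf m0) orbF pnatr_eq0.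
(* Otherwise [A] would be triangular with the real eigenvalue [A 1 1]. *)
have A10 : A 1 0 != 0.
  apply/eqP => A10; have : (A 1 1 - l) ^+ 2 + m ^+ 2 = 0.
    transitivity (l ^+ 2 + m ^+ 2 - (A 0 0 * A 1 1 - A 0 1 * A 1 0)).
      by rewrite A10 a0; ring.
    by rewrite detA' subrr.
  by move/eqP; rewrite paddr_eq0 ?sqr_ge0// !expf_eq0 (negPf m0) !andbF.
have e0 : eta 0 0 = 0.
  apply/eqP; move: h1; rewrite f0 mulr0 addr0 !mulf_eq0 (negPf A10) orbF.
  by rewrite pnatr_eq0 /=.
by apply: cV2P; rewrite mxE.
Qed.

Let D0 := axes_det_neq0.

Let of_coordE x y i : of_coord x y i 0 = center i 0 + x * axis1 i 0 + y * axis2 i 0.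
Proof. by rewrite /of_coord !mxE. Qed.

Lemma of_coordK v : of_coord (coordx v) (coordy v) = v.
Proof.
have D := D0; rewrite /axes_det in D.
apply: cV2P; rewrite of_coordE; move: D; rewrite /coordx /coordy /axes_det.
  move: (axis1 0 0) (axis1 1 0) (axis2 0 0) (axis2 1 0) => a b c d D.
  by field.
move: (axis1 0 0) (axis1 1 0) (axis2 0 0) (axis2 1 0) => a b c d D.
by field.
Qed.

Lemma coordxK x y : coordx (of_coord x y) = x.
Proof.
have D := D0; rewrite /axes_det in D.
rewrite /coordx !of_coordE; move: D; rewrite /axes_det.
move: (axis1 0 0) (axis1 1 0) (axis2 0 0) (axis2 1 0) => a b c d D.
by field.
Qed.

Lemma coordyK x y : coordy (of_coord x y) = y.
Proof.
have D := D0; rewrite /axes_det in D.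
rewrite /coordy !of_coordE; move: D; rewrite /axes_det.
move: (axis1 0 0) (axis1 1 0) (axis2 0 0) (axis2 1 0) => a b c d D.
by field.
Qed.

Lemma unitA : A \in unitmx.
Proof. by rewrite unitmxE detA unitfE (sqmod_neq0 l m_gt0). Qed.

Lemma mulmx_axis1 : A *m axis1 = l *: axis1 + m *: axis2.
Proof. by rewrite /axis2 (scalerA m m^-1) mulfV// scale1r addrC subrK. Qed.

(** This is Cayley-Hamilton in the form [(A - l)^2 = - m^2], verified entrywise. *)
Lemma mulmx_axis2 : A *m axis2 = - m *: axis1 + l *: axis2.
Proof.
rewrite /axis2; set b := axis1.
have a0 : A 0 0 = 2 * l - A 1 1 by rewrite -trA' addrK.
have bc : A 0 1 * A 1 0 = (2 * l - A 1 1) * A 1 1 - l ^+ 2 - m ^+ 2.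
  transitivity (A 0 0 * A 1 1 - (A 0 0 * A 1 1 - A 0 1 * A 1 0)); first by ring.
  by rewrite detA' a0; ring.
(* The two sides of each entry differ by a multiple of this vanishing expression. *)
have bc0 z : (A 0 1 * A 1 0 - ((2 * l - A 1 1) * A 1 1 - l ^+ 2 - m ^+ 2)) * z = 0.
  by rewrite bc subrr mul0r.
apply: cV2P; rewrite !mulmx2E !mxE !sum_ord2 ?mxE ?sum_ord2 a0; apply: (mulfI m0);
  apply: subr0_eq.
  by rewrite -[RHS](bc0 (control_rad * eta 0 0)); field.
by rewrite -[RHS](bc0 (control_rad * eta 1 0)); field.
Qed.

Lemma mulmx_center : A *m center = - control_mid *: eta.
Proof. by rewrite /center -scalemxAr mulmxA mulmxV ?unitA// mul1mx. Qed.

Lemma vector_fieldE c x y : A *m of_coord x y + c *: eta =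
  (l * x - m * y + normalized c) *: axis1 + (m * x + l * y) *: axis2.
Proof.
rewrite /of_coord !mulmxDr mulmx_center -(scalemxAr x) -(scalemxAr y).
rewrite mulmx_axis1 mulmx_axis2.
have ak z : z *: eta = (z / control_rad) *: axis1 by rewrite /axis1 scalerA divfK.
rewrite !ak /normalized; move: axis1 axis2 => a b.
by apply: cV2P; rewrite !mxE; ring.
Qed.

Let coordx_entries v (X : R -> 'cV[R]_2) s : is_derive s 1 X v ->
  is_derive s 1 (fun t => coordx (X t))
    ((v 0 0 * axis2 1 0 - v 1 0 * axis2 0 0) / axes_det).
Proof.
move=> /is_derive_mxP dX; have d0 := dX 0 0; have d1 := dX 1 0.
by rewrite /coordx; derive_by; ring.
Qed.

Let coordy_entries v (X : R -> 'cV[R]_2) s : is_derive s 1 X v ->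
  is_derive s 1 (fun t => coordy (X t))
    ((axis1 0 0 * v 1 0 - axis1 1 0 * v 0 0) / axes_det).
Proof.
move=> /is_derive_mxP dX; have d0 := dX 0 0; have d1 := dX 1 0.
by rewrite /coordy; derive_by; ring.
Qed.

Let vector_field_entries v c i : (A *m v + c *: eta) i 0 =
  (l * coordx v - m * coordy v + normalized c) * axis1 i 0
  + (m * coordx v + l * coordy v) * axis2 i 0.
Proof. by rewrite -{1}[v]of_coordK vector_fieldE !mxE. Qed.

Lemma is_derive_coordx (X : R -> 'cV[R]_2) s c :
  is_derive s 1 X (A *m X s + c *: eta) ->
  is_derive s 1 (fun t => coordx (X t))
    (l * coordx (X s) - m * coordy (X s) + normalized c).
Proof.
move=> /coordx_entries; rewrite !vector_field_entries => d.
apply: is_derive_eq; move: D0; rewrite /axes_det.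
move: (axis1 0 0) (axis1 1 0) (axis2 0 0) (axis2 1 0) => a b c' d' D.
by field.
Qed.

Lemma is_derive_coordy (X : R -> 'cV[R]_2) s c :
  is_derive s 1 X (A *m X s + c *: eta) ->
  is_derive s 1 (fun t => coordy (X t)) (m * coordx (X s) + l * coordy (X s)).
Proof.
move=> /coordy_entries; rewrite !vector_field_entries => d.
apply: is_derive_eq; move: D0; rewrite /axes_det.
move: (axis1 0 0) (axis1 1 0) (axis2 0 0) (axis2 1 0) => a b c' d' D.
by field.
Qed.

Lemma is_derive_of_coord (X Y : R -> R) s a b :
  is_derive s 1 X a -> is_derive s 1 Y b ->
  is_derive s 1 (fun t => of_coord (X t) (Y t)) (a *: axis1 + b *: axis2).
Proof.
move=> dX dY; apply/is_derive_mxP => i j; rewrite (ord1 j).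
rewrite (_ : (fun t => _) = fun t => center i 0 + X t * axis1 i 0 + Y t * axis2 i 0).
  by derive_by; rewrite !mxE; ring.
by apply/funext => t; rewrite of_coordE.
Qed.

Lemma cvg_of_coord (T : Type) (B : set_system T) (X Y : T -> R) x y :
  Filter B -> X @ B --> x -> Y @ B --> y ->
  (fun a => of_coord (X a) (Y a)) @ B --> of_coord x y.
Proof.
move=> FB hX hY; rewrite /of_coord; apply: cvgD; last exact: cvgZr_tmp.
by apply: cvgD; [exact: cvg_cst|exact: cvgZr_tmp].
Qed.

Let cvg_entry i v :
  (fun w : 'cV[R]_2 => w i 0 - center i 0) @ nbhs v --> v i 0 - center i 0.
Proof. by apply: cvgB; [exact: coord_continuous|exact: cvg_cst]. Qed.

Lemma continuous_coordx : continuous coordx.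
Proof.
move=> v; change (coordx @ nbhs v --> coordx v); rewrite /coordx.
by apply: cvgMr_tmp; apply: cvgB; apply: cvgMr_tmp; exact: cvg_entry.
Qed.

Lemma continuous_coordy : continuous coordy.
Proof.
move=> v; change (coordy @ nbhs v --> coordy v); rewrite /coordy.
by apply: cvgMr_tmp; apply: cvgB; apply: cvgMl_tmp; exact: cvg_entry.
Qed.

End SpiralCoordinates.

(** * Solutions for a constant control *)

Section ConstantControl.
Context {R : realType}.
Variables (A : 'M[R]_2) (eta : 'cV[R]_2) (l m um up : R).
Hypotheses (m_gt0 : 0 < m) (um_lt_up : um < up) (eta_neq0 : eta != 0).
Hypotheses (trA : \tr A = 2 * l) (detA : \det A = l ^+ 2 + m ^+ 2).
Implicit Types (v w : 'cV[R]_2) (x y s t c : R).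

Local Notation cx := (coordx A eta l m um up).
Local Notation cy := (coordy A eta l m um up).
Local Notation pt := (of_coord A eta l m um up).
Local Notation fl := (flow A eta l m um up).
Local Notation nu := (normalized um up).

Let ptK v : pt (cx v) (cy v) = v. Proof. exact: of_coordK. Qed.
Let cxK x y : cx (pt x y) = x. Proof. exact: coordxK. Qed.
Let cyK x y : cy (pt x y) = y. Proof. exact: coordyK. Qed.

Lemma coord_inj v w : cx v = cx w -> cy v = cy w -> v = w.
Proof. by move=> ex ey; rewrite -[v]ptK ex ey ptK. Qed.

Lemma coordx_flow c t v : cx (fl c t v) = flowx l m (nu c) t (cx v) (cy v).
Proof. exact: cxK. Qed.

Lemma coordy_flow c t v : cy (fl c t v) = flowy l m (nu c) t (cx v) (cy v).
Proof. exact: cyK. Qed.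

Lemma flow0 c v : fl c 0 v = v.
Proof. by rewrite /flow flowx0 flowy0 ptK. Qed.

Lemma flowD c s t v : fl c (s + t) v = fl c s (fl c t v).
Proof. by rewrite /flow cxK cyK flowxD flowyD. Qed.

Lemma is_derive_flow c s v :
  is_derive s 1 (fun t => fl c t v) (A *m fl c s v + c *: eta).
Proof.
rewrite {2}/flow vector_fieldE//.
by apply: is_derive_of_coord => //; [exact: is_derive_flowx|exact: is_derive_flowy].
Qed.

Lemma continuous_flow c v : continuous (fun t => fl c t v).
Proof.
move=> s; have [d _] := is_derive_flow c s v.
exact/differentiable_continuous/derivable1_diffP.
Qed.

Lemma discontinuities_cst c s : ~ discontinuities (cst c) s.
Proof. by apply; exact: cvg_cst. Qed.

Lemma flow_is_phi c v : is_phi A eta v (cst c) (fun t => fl c t v).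
Proof.
split; [exact: continuous_flow|exact: flow0|move=> s _; exact: is_derive_flow].
Qed.

(** Transported back to time 0 by the closed formula for the flow, a solution has derivative zero
    and is therefore constant. *)
Lemma flow_unique c v X : is_phi A eta v (cst c) X -> X = fun t => fl c t v.
Proof.
move=> [_ X0 dX]; apply/funext => s.
have dXs t : is_derive t 1 X (A *m X t + c *: eta).
  exact: dX (@discontinuities_cst c t).
pose k := nu c; pose x t := cx (X t); pose y t := cy (X t).
have dx t : is_derive t 1 x (l * x t - m * y t + k).
  exact: is_derive_coordx.
have dy t : is_derive t 1 y (m * x t + l * y t) by exact: is_derive_coordy.
have N0 := sqmod_neq0 l m_gt0; rewrite /sqmod in N0.
have dfx t : is_derive t 1 (fun t => flowx l m k (- t) (x t) (y t)) 0.
  have dxt := dx t; have dyt := dy t.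
  by rewrite /flowx /spiral_re /spiral_im; derive_by; rewrite /sqmod; field.
have dfy t : is_derive t 1 (fun t => flowy l m k (- t) (x t) (y t)) 0.
  have dxt := dx t; have dyt := dy t.
  by rewrite /flowy /spiral_re /spiral_im; derive_by; rewrite /sqmod; field.
have ex := is_derive_0_is_cst s 0 dfx; have ey := is_derive_0_is_cst s 0 dfy.
rewrite /= oppr0 flowx0 flowy0 /x /y X0 -/k in ex ey.
rewrite -[X s](flow0 c) -[0](subrr s) flowD.
congr (fl c s _); apply: coord_inj; rewrite ?coordx_flow ?coordy_flow //.
Qed.

Lemma constant_arcE v c :
  constant_arc A eta m v c = [set w | exists2 s, 0 <= s <= halfturn m & w = fl c s v].
Proof.
apply/seteqP; split=> w /=.
  move=> [X [s [hX sT ->]]]; exists s; first by move: sT; rewrite in_itv.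
  by rewrite (flow_unique hX).
move=> [s sT ->]; exists (fun t => fl c t v), s; split=> //.
exact: flow_is_phi.
Qed.

Lemma normalized_up : nu up = 1.
Proof.
rewrite /normalized /control_mid /control_rad; field.
by rewrite subr_eq0 gt_eqF.
Qed.

Lemma normalized_um : nu um = -1.
Proof.
rewrite /normalized /control_mid /control_rad; field.
by rewrite subr_eq0 gt_eqF.
Qed.

Lemma normalized_le1 c : um <= c <= up -> `|nu c| <= 1.
Proof.
move=> /andP[umc cup]; have k0 := control_rad_gt0 um_lt_up.
rewrite /normalized normrM normfV (gtr0_norm k0) ler_pdivrMr// mul1r.
by rewrite ler_norml /control_mid /control_rad; apply/andP; split; lra.
Qed.

(** [A^-1] acts on [eta] as division by [alpha], and [center] is itself a multiple of [A^-1 eta],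
    whence the shift of [k] by [control_mid]. *)
Lemma scale_center_of_coord k :
  k *: (invmx A *m eta) = pt ((k + control_mid um up) / control_rad um up * (l / sqmod l m))
    ((k + control_mid um up) / control_rad um up * - (m / sqmod l m)).
Proof.
have uA : A \in unitmx := unitA m_gt0 detA.
have k0 : control_rad um up != 0 by rewrite gt_eqF ?control_rad_gt0.
have N0 := sqmod_neq0 l m_gt0.
have e0 : invmx A *m eta = (control_rad um up)^-1 *:
    ((l / sqmod l m) *: axis1 eta um up - (m / sqmod l m) *: axis2 A eta l m um up).
  apply: (can_inj (mulKmx uA)); rewrite mulKVmx// -scalemxAr mulmxBr.
  rewrite -(scalemxAr (l / _)) -(scalemxAr (m / _)) (mulmx_axis1 A eta l um up m_gt0).
  rewrite (mulmx_axis2 eta um up m_gt0 trA detA).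
  apply: (scalerI k0); rewrite scalerA mulfV// scale1r -/(axis1 eta um up).
  move: (axis1 _ _ _) (axis2 _ _ _ _ _ _) => a b.
  by apply: cV2P; rewrite !mxE; move: N0; rewrite /sqmod => N0; field.
rewrite /of_coord /center e0; move: (axis1 _ _ _) (axis2 _ _ _ _ _ _) => a b.
by apply: cV2P; rewrite !mxE; field; rewrite N0 k0.
Qed.

End ConstantControl.

(** * The periodic orbit as a level set *)

Section PeriodicOrbit.
Context {R : realType}.
Variables (A : 'M[R]_2) (eta : 'cV[R]_2) (l m um up : R).
Hypotheses (m_gt0 : 0 < m) (um_lt_up : um < up) (eta_neq0 : eta != 0).
Hypotheses (trA : \tr A = 2 * l) (detA : \det A = l ^+ 2 + m ^+ 2).
Hypothesis l_lt0 : l < 0.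

Definition level (v : 'cV[R]_2) : R :=
  gauge l m (coordx A eta l m um up v) (coordy A eta l m um up v).

(** In the complex coordinate the point is [k / alpha]; [k = apex] gives P^- and [k = - apex] gives
    P^+. *)
Lemma switch_pointE a b k :
  (- a + decay l m * b) / (1 - decay l m) = k * control_rad um up - control_mid um up ->
  switch_point A eta l m a b =
  of_coord A eta l m um up (k * (l / sqmod l m)) (k * - (m / sqmod l m)).
Proof.
move=> e; rewrite /switch_point -/(decay l m) e.
rewrite (scale_center_of_coord eta m_gt0 um_lt_up trA detA).
by rewrite subrK mulfK// gt_eqF// control_rad_gt0.
Qed.

Let q1 : 1 - decay l m != 0.
Proof. by rewrite subr_eq0 gt_eqF// decay_lt1. Qed.

Lemma upper_arcE : constant_arc A eta m (switch_point A eta l m um up) up =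
  [set w | exists2 s, 0 <= s <= halfturn m &
     w = of_coord A eta l m um up (orbitx l m s) (orbity l m s)].
Proof.
rewrite (constant_arcE m_gt0 um_lt_up eta_neq0 trA detA).
rewrite (@switch_pointE _ _ (apex l m)); last first.
  by rewrite /apex /control_rad /control_mid; field.
have flE s : flow A eta l m um up up s (of_coord A eta l m um up
    (apex l m * (l / sqmod l m)) (apex l m * - (m / sqmod l m))) =
    of_coord A eta l m um up (orbitx l m s) (orbity l m s).
  by rewrite /flow coordxK// coordyK// normalized_up.
by apply/seteqP; split=> w [s sT ->]; exists s.
Qed.

Lemma lower_arcE : constant_arc A eta m (switch_point A eta l m up um) um =
  [set w | exists2 s, 0 <= s <= halfturn m &
     w = of_coord A eta l m um up (- orbitx l m s) (- orbity l m s)].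
Proof.
rewrite (constant_arcE m_gt0 um_lt_up eta_neq0 trA detA).
rewrite (@switch_pointE _ _ (- apex l m)); last first.
  by rewrite /apex /control_rad /control_mid; field.
have flE s : flow A eta l m um up um s (of_coord A eta l m um up
    (- apex l m * (l / sqmod l m)) (- apex l m * - (m / sqmod l m))) =
    of_coord A eta l m um up (- orbitx l m s) (- orbity l m s).
  rewrite /flow coordxK// coordyK// normalized_um// /orbitx /orbity /flowx /flowy.
  by congr of_coord; ring.
by apply/seteqP; split=> w [s sT ->]; exists s.
Qed.

Lemma periodic_orbitE : periodic_orbit A eta l m um up = [set v | level v = 1].
Proof.
rewrite /periodic_orbit upper_arcE lower_arcE; apply/seteqP; split=> v /=.
  by move=> [] [s sT ->]; rewrite /level coordxK// coordyK// ?gaugeN// gauge_orbit.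
move=> /(gauge_eq1_orbit m_gt0 l_lt0)[s sT [[ex ey]|[ex ey]]]; [right|left];
  exists s => //; rewrite -ex -ey of_coordK//.
Qed.

End PeriodicOrbit.

(** * The region delimited by the periodic orbit *)

Section LevelSets.
Context {R : realType}.
Variables (A : 'M[R]_2) (eta : 'cV[R]_2) (l m um up : R).
Hypotheses (m_gt0 : 0 < m) (um_lt_up : um < up) (eta_neq0 : eta != 0).
Hypotheses (trA : \tr A = 2 * l) (detA : \det A = l ^+ 2 + m ^+ 2).
Hypothesis l_lt0 : l < 0.
Implicit Types (v w : 'cV[R]_2) (x y s t c : R).

Local Notation cx := (coordx A eta l m um up).
Local Notation cy := (coordy A eta l m um up).
Local Notation pt := (of_coord A eta l m um up).
Local Notation lev := (level A eta l m um up).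
Local Notation ctr := (center A eta um up).

Let ptK v : pt (cx v) (cy v) = v. Proof. exact: of_coordK. Qed.
Let cxK x y : cx (pt x y) = x. Proof. exact: coordxK. Qed.
Let cyK x y : cy (pt x y) = y. Proof. exact: coordyK. Qed.

Definition dilate t v := pt (t * cx v) (t * cy v).

Lemma level_dilate t v : lev (dilate t v) = `|t| * lev v.
Proof. by rewrite /level /dilate cxK cyK gaugeZ. Qed.

Lemma dilate1 v : dilate 1 v = v.
Proof. by rewrite /dilate !mul1r ptK. Qed.

Lemma dilate0 v : dilate 0 v = ctr.
Proof. by rewrite /dilate !mul0r /of_coord !scale0r !addr0. Qed.

Lemma coordx_center : cx ctr = 0.
Proof. by rewrite -(dilate0 0) /dilate cxK mul0r. Qed.

Lemma coordy_center : cy ctr = 0.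
Proof. by rewrite -(dilate0 0) /dilate cyK mul0r. Qed.

Lemma level_center : lev ctr = 0.
Proof. by rewrite /level coordx_center coordy_center gauge00. Qed.

Lemma level_ge0 v : 0 <= lev v. Proof. exact: gauge_ge0. Qed.

Lemma continuous_dilate v : continuous (dilate^~ v).
Proof.
move=> t; apply: cvg_of_coord; apply: cvgMr_tmp; exact: cvg_id.
Qed.

Lemma continuous_level : continuous lev.
Proof.
by move=> v; apply: continuous_gauge => //;
  [exact: continuous_coordx|exact: continuous_coordy].
Qed.

Definition region : set 'cV[R]_2 := [set v | lev v < 1].

Lemma open_region : open region.
Proof.
rewrite (_ : region = lev @^-1` [set x | x < 1])//.
by apply: open_comp; [move=> v _; exact: continuous_level|exact: open_lt].
Qed.

Lemma closed_level_le1 : closed [set v | lev v <= 1].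
Proof.
rewrite (_ : [set v | lev v <= 1] = lev @^-1` [set x | x <= 1])//.
by apply: preimage_closed; [move=> v _; exact: continuous_level|exact: closed_le].
Qed.

(** A point of level 1 is the limit of its dilates of ratio below 1. *)
Lemma closure_region : closure region = [set v | lev v <= 1].
Proof.
apply/seteqP; split=> [v|v /= v1].
  rewrite [X in _ -> X v](closure_id _).1; last exact: closed_level_le1.
  by apply: closureS => w /ltW.
move=> B Bv; have Bd : \forall t \near 1^'-, B (dilate t v).
  have h : dilate^~ v @ 1^'- --> dilate 1 v.
    exact: (cvg_at_left_filter (@continuous_dilate v 1)).
  by apply: h; rewrite dilate1.
near (1 : R)^'- => t.
have Bt : B (dilate t v) by near: t.
have t1 : t < 1 by near: t; exact: nbhs_left_lt.
have t0 : 0 < t by near: t; exact: nbhs_left_gt.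
exists (dilate t v); split=> //; rewrite /region /= level_dilate gtr0_norm//.
by rewrite (le_lt_trans _ t1)// ler_piMr// ltW.
Unshelve. all: by end_near. Qed.

(** Dilating a point of level 1 by any ratio above 1 leaves the set, so such a point is not
    interior. *)
Lemma interior_level_le1 : interior [set v | lev v <= 1] = region.
Proof.
apply/seteqP; split=> [v vi|]; last first.
  by rewrite -open_subsetE; [move=> w /ltW|exact: open_region].
have Bd : \forall t \near 1^'+, lev (dilate t v) <= 1.
  have h : dilate^~ v @ 1^'+ --> dilate 1 v.
    exact: (cvg_at_right_filter (@continuous_dilate v 1)).
  by move: vi; rewrite -{1}[v]dilate1 => /h.
near (1 : R)^'+ => t.
have Bt : lev (dilate t v) <= 1 by near: t.
have t1 : 1 < t by near: t; exact: nbhs_right_gt.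
rewrite /= level_dilate gtr0_norm ?(lt_trans ltr01)// in Bt.
rewrite /region /=; have [//|v1] := ltrP (lev v) 1.
suff : 1 < t * lev v by rewrite ltNge Bt.
by rewrite (lt_le_trans t1)// ler_peMr// ltW// (lt_trans ltr01).
Unshelve. all: by end_near. Qed.

(** The region is star-shaped about [center]. *)
Lemma connected_region : connected region.
Proof.
rewrite (_ : region = \bigcup_(v in region) (dilate^~ v @` `[0, 1])).
  apply: bigcup_connected.
    exists ctr => v _; exists 0; last by rewrite dilate0.
    by rewrite /= in_itv /= lexx ler01.
  move=> v _; apply: connected_continuous_connected; first exact: segment_connected.
  exact/continuous_subspaceT/continuous_dilate.
apply/seteqP; split=> [v v1|w [v v1 [t]]].
  by exists v => //; exists 1; rewrite ?dilate1//= in_itv /= lexx ler01.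
rewrite /= in_itv /= => /andP[t0 t1] <-; rewrite /region /= level_dilate ger0_norm//.
by rewrite (le_lt_trans _ v1)// ler_piMl// level_ge0.
Qed.

Lemma bounded_region : bounded_set region.
Proof.
have [K K0 hK] := gauge_coord m_gt0 l_lt0.
exists (`|ctr| + K * (`|axis1 eta um up| + `|axis2 A eta l m um up|)).
split; first exact: num_real.
move=> M hM v v1 /=; apply: (le_trans _ (ltW hM)).
rewrite -[v]ptK /of_coord -addrA (le_trans (ler_normD _ _))// lerD2l.
rewrite (le_trans (ler_normD _ _))// (normrZ (cx v)) (normrZ (cy v)) (mulrDr K).
have [hx hy] := hK (cx v) (cy v).
have KF : K * gauge l m (cx v) (cy v) <= K by rewrite ler_piMr// ltW.
by apply: lerD; rewrite ler_wpM2r//; [exact: le_trans hx KF|exact: le_trans hy KF].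
Qed.

Lemma unbounded_ray v : 0 < lev v -> ~ bounded_set (dilate^~ v @` [set t | 1 <= t]).
Proof.
move=> v0 [M [Mreal hM]]; pose d := v - ctr.
have d0 : 0 < `|d|.
  rewrite normr_gt0 subr_eq0; apply/eqP => ev; move: v0.
  by rewrite ev level_center ltxx.
have dv : d = cx v *: axis1 eta um up + cy v *: axis2 A eta l m um up.
  by apply/eqP; rewrite subr_eq addrC addrA -/(pt (cx v) (cy v)) ptK.
have dE t : dilate t v = ctr + t *: d.
  by rewrite dv scalerDr (scalerA t (cx v)) (scalerA t (cy v)) addrA.
pose N := Num.max M 0 + 1.
have N0 : 0 <= N by rewrite addr_ge0// le_max lexx orbT.
have MN : M < N by rewrite ltr_pwDr// le_max lexx.
(* With this [t] the norm of [t d] exceeds [N + |ctr|]. *)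
pose t := (N + `|ctr|) / `|d| + 1.
have t0 : 1 <= t by rewrite /t lerDr divr_ge0 ?normr_ge0 ?(addr_ge0 N0).
have := hM N MN _ (ex_intro2 _ _ t t0 erefl); rewrite /= dE => h.
have : `|t *: d| <= N + `|ctr|.
  by rewrite -[t *: d](addKr ctr) (le_trans (ler_normD _ _))// normrN addrC lerD2r.
rewrite normrZ (ger0_norm (le_trans ler01 t0)) -ler_pdivlMr// /t.
by rewrite gerDl ler10.
Qed.

(** Off the level 1 the conditions [lev < 1] and [lev <= 1] coincide, so the region is both open and
    closed there; being connected, it is a whole component. *)
Lemma component_region v : lev v < 1 ->
  connected_component (~` [set w | lev w = 1]) v = region.
Proof.
move=> v1; apply/seteqP; split; last first.
  apply: connected_component_max => //; last exact: connected_region.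
  by move=> w w1 w1'; move: w1; rewrite /region /= w1' ltxx.
set K := connected_component _ _.
have KO : K `<=` ~` [set w | lev w = 1] by exact: connected_component_sub.
have Kv : K v by apply: connected_component_refl => /= v1'; move: v1; rewrite v1' ltxx.
have cK : connected K by exact: component_connected.
suff <- : K `&` region = K by apply: subIsetr.
apply: cK; first by exists v.
- by exists region => //; exact: open_region.
- exists [set w | lev w <= 1]; first exact: closed_level_le1.
  apply/seteqP; split=> w [Kw w1]; split=> //=; first exact: ltW.
  by rewrite /region /= lt_neqAle w1 andbT; apply/eqP; exact: KO.
Qed.

(** The ray from [v] away from the centre avoids the level 1 and is unbounded. *)
Lemma unbounded_component v : 1 < lev v ->
  ~ bounded_set (connected_component (~` [set w | lev w = 1]) v).
Proof.
move=> v1 bK; have v0 : 0 < lev v by rewrite (lt_trans ltr01).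
apply: (unbounded_ray v0); case: bK => M [Mreal hM]; exists M; split=> // N MN w wr.
apply: hM MN _ _; move: w wr; apply: connected_component_max.
- by exists 1; rewrite ?dilate1//=.
- move=> _ [t /= t1 <-]; rewrite level_dilate ger0_norm ?(le_trans ler01)//.
  by apply/eqP; rewrite gt_eqF// (lt_le_trans v1)// ler_peMl// ltW.
- apply: connected_continuous_connected; last exact/continuous_subspaceT/continuous_dilate.
  apply/connected_intervalP => a b /= a1 b1 t /andP[+ _].
  exact: le_trans.
Qed.

Lemma delimited_regionE : delimited_region (periodic_orbit A eta l m um up) = region.
Proof.
rewrite periodic_orbitE// /delimited_region; apply: xget_unique.
  split; last exact: bounded_region.
  exists ctr; first by rewrite /= level_center => /eqP; rewrite eq_sym oner_eq0.
  by rewrite component_region// level_center.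
move=> B [[v /= v1 ->] bB].
have [v1'|v1'|//] := ltgtP (lev v) 1; first exact: component_region.
by case: (unbounded_component v1').
Qed.

End LevelSets.

(** * Trajectories *)

Section TimeReversal.
Context {R : realType}.
Implicit Types (u : R -> R) (s t : R).

Lemma cvg_time_reversal s t : s - t' @[t' --> t] --> s - t.
Proof. by apply: cvgB; [exact: cvg_cst|exact: cvg_id]. Qed.

Lemma continuous_time_reversal u s t :
  {for s - t, continuous u} -> {for t, continuous (fun t' => u (s - t'))}.
Proof.
by move=> cu; exact: (cvg_comp _ u (@cvg_time_reversal s t) cu).
Qed.

Lemma discontinuities_time_reversal u s t :
  discontinuities (fun t' => u (s - t')) t <-> discontinuities u (s - t).
Proof.
split=> h c; apply: h; first exact: continuous_time_reversal.
have := @continuous_time_reversal (fun t' => u (s - t')) s (s - t).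
rewrite subKr => /(_ c); rewrite (_ : (fun t' => u (s - (s - t'))) = u)//.
by apply/funext => t'; rewrite subKr.
Qed.

Lemma control_functions_time_reversal (Omega : set R) u s :
  control_functions Omega u -> control_functions Omega (fun t => u (s - t)).
Proof.
move=> [[fin loc] uO]; split; last by move=> t; exact: uO.
split=> [a b|t /discontinuities_time_reversal ct].
  apply: (@sub_finite_set _ _ ((fun t => s - t) @` (discontinuities u `&` `[s - b, s - a]))).
    move=> t [/discontinuities_time_reversal dt /=]; rewrite in_itv /= => /andP[ta tb].
    exists (s - t); last by rewrite subKr.
    by split=> //=; rewrite in_itv /=; apply/andP; split; lra.
  exact: finite_image.
exact: (@cvg_time_reversal s t _ (loc _ ct)).
Qed.

Lemma is_phi_time_reversal (A : 'M[R]_2) (eta v : 'cV[R]_2) u x s :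
  is_phi A eta v u x ->
  is_phi (- A) (- eta) (x s) (fun t => u (s - t)) (fun t => x (s - t)).
Proof.
move=> [cx x0 dx]; split; last 1 first.
- move=> t ct; have dt := dx (s - t) (fun h => ct ((discontinuities_time_reversal _ _ _).2 h)).
  have ds : is_derive t 1 (fun t' => s - t') (- 1).
    by derive_by; ring.
  apply/is_derive_mxP => i j; have /is_derive_mxP/(_ i j) dij := dt.
  have := is_derive1_comp (f := fun t => x t i j) (g := fun t' => s - t') dij ds.
  move=> h; apply: is_derive_eq.
  by rewrite mulNmx scalerN !mxE; ring.
- by move=> t; exact: (cvg_comp _ x (@cvg_time_reversal s t) (cx _)).
- by rewrite subr0.
Qed.

Lemma positive_orbit_time_reversal (A : 'M[R]_2) (eta v w : 'cV[R]_2) (Omega : set R) :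
  positive_orbit A eta Omega v w -> positive_orbit (- A) (- eta) Omega w v.
Proof.
move=> [u [x [s [hu hx s0 ->]]]].
exists (fun t => u (s - t)), (fun t => x (s - t)), s; split=> //.
- exact: control_functions_time_reversal.
- exact: is_phi_time_reversal hx.
- by case: hx => _ <- _; rewrite subrr.
Qed.

End TimeReversal.

Section Extension.
Context {R : realType}.
Variables (A : 'M[R]_2) (eta : 'cV[R]_2) (l m um up : R).
Hypotheses (m_gt0 : 0 < m) (um_lt_up : um < up) (eta_neq0 : eta != 0).
Hypotheses (trA : \tr A = 2 * l) (detA : \det A = l ^+ 2 + m ^+ 2).
Implicit Types (v w : 'cV[R]_2) (s t c : R).

Local Notation Omega := `[um, up]%classic.
Local Notation fl := (flow A eta l m um up).
Local Notation Orb := (positive_orbit A eta Omega).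

Let um_in : Omega um. Proof. by rewrite /= in_itv /= lexx ltW. Qed.
Let up_in : Omega up. Proof. by rewrite /= in_itv /= lexx andbT ltW. Qed.

Lemma control_cst c : Omega c -> control_functions Omega (cst c).
Proof.
move=> cO; split=> //; split=> [a b|s _]; last exact: filterE.
rewrite (_ : _ `&` _ = set0) ?finite_set0//.
by rewrite -subset0 => s [/(@discontinuities_cst R c s)].
Qed.

Let two_values c : exists2 b, Omega b & b != c.
Proof.
have [->|uc] := eqVneq c um; first by exists up; rewrite ?gt_eqF.
by exists um; rewrite // eq_sym.
Qed.

(* The value at the junction [s] is chosen different from [c], so that [s] is a
   discontinuity and the differential equation imposes nothing there. *)
Lemma extend_by_constant v u x s c : control_functions Omega u ->
  is_phi A eta v u x -> 0 <= s -> Omega c ->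
  exists u' x', [/\ control_functions Omega u', is_phi A eta v u' x',
    forall t, t <= s -> x' t = x t &
    forall t, s <= t -> x' t = fl c (t - s) (x s)].
Proof.
move=> [[fin loc] uO] [cx x0 dx] s0 cO; have [b bO bc] := two_values c.
pose u' t := if t < s then u t else if t == s then b else c.
(* The minimum and the maximum make [x'] continuous by construction; on each side of [s] one of the
   first two terms equals [x s] and cancels. *)
pose x' t := x (Num.min t s) + fl c (Num.max t s - s) (x s) - x s.
have x'l t : t <= s -> x' t = x t.
  by move=> ts; rewrite /x' min_l// max_r// subrr flow0// addrK.
have x'r t : s <= t -> x' t = fl c (t - s) (x s).
  by move=> st; rewrite /x' min_r// max_l// addrAC subrr add0r.
have u'l t : t < s -> \forall t' \near t, u' t' = u t'.
  by move=> ts; near=> t'; rewrite /u' ifT//; near: t'; exact: lt_nbhsl.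
have u'r t : s < t -> \forall t' \near t, u' t' = c.
  move=> st; near=> t'; have st' : s < t' by near: t'; exact: lt_nbhsr.
  by rewrite /u' ltNge (ltW st') /= gt_eqF.
have du's : discontinuities u' s.
  move=> cu'; suff : b = c by move/eqP; rewrite (negPf bc).
  have u's : u' s = b by rewrite /u' ltxx eqxx.
  have h1 : u' @ s^'+ --> b.
    by rewrite -u's; exact: (cvg_at_right_filter cu').
  have h2 : u' @ s^'+ --> c.
    apply: cvg_near_cst; near=> t'; have st' : s < t' by near: t'; exact: nbhs_right_gt.
    by rewrite /u' ltNge (ltW st') /= gt_eqF.
  exact: (cvg_unique (@Rhausdorff R) h1 h2).
have cu'l t : t < s -> ~ discontinuities u' t -> ~ discontinuities u t.
  move=> ts; apply: contra_not => dt cu'; apply: dt.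
  have h := u'l t ts; rewrite /prop_for /continuous_at -(nbhs_singleton h).
  by apply: cvg_trans cu'; apply: near_eq_cvg; near=> t'; near: t'.
have du'l t : discontinuities u' t -> t = s \/ discontinuities u t.
  move=> dt; have [ts|st|->] := ltgtP t s; [right|exfalso|by left].
    move=> cu; apply: dt; have h := u'l t ts.
    rewrite /prop_for /continuous_at (nbhs_singleton h).
    apply: cvg_trans cu; apply: near_eq_cvg; near=> t'; apply/esym; near: t'; exact: h.
  apply: dt; have h := u'r t st; rewrite /prop_for /continuous_at (nbhs_singleton h).
  exact: cvg_near_cst.
exists u', x'; split; [| |exact: x'l|exact: x'r].
- split; last by move=> t; rewrite /u'; case: ifP => // _; case: ifP.
  split=> [a d|t ct].
    apply: (@sub_finite_set _ _ ([set s] `|` (discontinuities u `&` `[a, d]))).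
      by move=> t [/du'l[->|dt] td]; [left|right].
    by rewrite finite_setU; split=> //; exact: finite_set1.
  have [ts|st|ts] := ltgtP t s.
  + have h := u'l t ts; rewrite (nbhs_singleton h); have := loc t (cu'l t ts ct).
    by move: h; apply: filterS2 => t' ->.
  + by have h := u'r t st; rewrite (nbhs_singleton h).
  + by exfalso; apply: ct; rewrite ts.
- split; last 1 first.
  + move=> t ct; have [ts|st|ts] := ltgtP t s.
    * have dt := dx t (cu'l t ts ct).
      rewrite (x'l t (ltW ts)) (nbhs_singleton (u'l t ts)).
      apply: (near_eq_is_derive _ dt).
      by near=> t'; apply/esym/x'l/ltW; near: t'; exact: lt_nbhsl.
    * rewrite (x'r t (ltW st)) (nbhs_singleton (u'r t st)).
      have dt : is_derive t 1 (fun t' => fl c (t' - s) (x s))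
          (A *m fl c (t - s) (x s) + c *: eta).
        have d := is_derive_flow eta m_gt0 um_lt_up trA detA c (t - s) (x s).
        have ds : is_derive t 1 (fun t' => t' - s) 1 by derive_by; ring.
        apply/is_derive_mxP => i j; have /is_derive_mxP/(_ i j) dij := d.
        have := is_derive1_comp (f := fun t => fl c t (x s) i j) (g := fun t' => t' - s) dij ds.
        by rewrite mulr1.
      apply: (near_eq_is_derive _ dt).
      by near=> t'; apply/esym/x'r/ltW; near: t'; exact: lt_nbhsr.
    * by exfalso; apply: ct; rewrite ts.
  + move=> t; rewrite /x'; apply: cvgB; last exact: cvg_cst.
    apply: cvgD.
      have h : {for t, continuous (fun t => Num.min t s)}.
        by apply: continuous_min; [exact: cvg_id|exact: cvg_cst].
      exact: (cvg_comp _ x h (cx _)).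
    have h : Num.max t' s - s @[t' --> t] --> Num.max t s - s.
      apply: cvgB; last exact: cvg_cst.
      by apply: (@continuous_max _ _ id (cst s)); [exact: cvg_id|exact: cvg_cst].
    apply: (cvg_comp _ (fun t => fl c t (x s)) h).
    exact: continuous_flow.
  + by rewrite x'l.
Unshelve. all: by end_near. Qed.

Lemma positive_orbit_refl v : Orb v v.
Proof.
exists (cst um), (fun t => fl um t v), 0; split=> //.
- exact: control_cst.
- exact: flow_is_phi.
- by rewrite flow0.
Qed.

Lemma positive_orbit_flow v w c t : Orb v w -> Omega c -> 0 <= t -> Orb v (fl c t w).
Proof.
move=> [u [x [s [hu hx s0 ->]]]] cO t0.
have [u' [x' [hu' hx' _ x'r]]] := extend_by_constant hu hx s0 cO.
exists u', x', (s + t); split=> //; first by rewrite addr_ge0.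
by rewrite x'r ?lerDl// addrAC subrr add0r.
Qed.

Lemma positive_orbit_level_lt1 v w : l < 0 -> Orb v w ->
  level A eta l m um up v < 1 -> level A eta l m um up w < 1.
Proof.
move=> l0 [u [x [s [[[fin _] uO] [cx x0 dx] s_ge0 ->]]]]; rewrite -x0.
apply: (@gauge_lt1_forward _ l m m_gt0 l0 (fun t => coordx A eta l m um up (x t))
  (fun t => coordy A eta l m um up (x t)) (fun t => normalized um up (u t))
  (discontinuities u) _ _ fin _ _ _ 0 s s_ge0).
- by move=> t; exact: (cvg_comp x _ (cx t) (@continuous_coordx _ _ _ _ _ _ _ _)).
- by move=> t; exact: (cvg_comp x _ (cx t) (@continuous_coordy _ _ _ _ _ _ _ _)).
- by move=> t; apply: normalized_le1 => //; have := uO t; rewrite /= in_itv.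
- by move=> t /dx; exact: is_derive_coordx.
- by move=> t /dx; exact: is_derive_coordy.
Qed.

Lemma positive_orbit_level_le1 v w : l < 0 -> Orb v w ->
  level A eta l m um up v <= 1 -> level A eta l m um up w <= 1.
Proof.
move=> l0 [u [x [s [[[fin _] uO] [cx x0 dx] s_ge0 ->]]]]; rewrite -x0.
apply: (@gauge_le1_forward _ l m m_gt0 l0 (fun t => coordx A eta l m um up (x t))
  (fun t => coordy A eta l m um up (x t)) (fun t => normalized um up (u t))
  (discontinuities u) _ _ fin _ _ _ 0 s s_ge0).
- by move=> t; exact: (cvg_comp x _ (cx t) (@continuous_coordx _ _ _ _ _ _ _ _)).
- by move=> t; exact: (cvg_comp x _ (cx t) (@continuous_coordy _ _ _ _ _ _ _ _)).
- by move=> t; apply: normalized_le1 => //; have := uO t; rewrite /= in_itv.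
- by move=> t /dx; exact: is_derive_coordx.
- by move=> t /dx; exact: is_derive_coordy.
Qed.

End Extension.

(** * Reachability *)

Section PlanarFlow.
Context {R : realType}.
Variables l m : R.
Hypothesis m_gt0 : 0 < m.
Implicit Types x y s t c : R.

Local Notation T := (halfturn m).
Local Notation q := (decay l m).
Local Notation fx := (flowx l m).
Local Notation fy := (flowy l m).

Lemma flowxZ e c t x y : fx (e * c) t (e * x) (e * y) = e * fx c t x y.
Proof. by rewrite /flowx; ring. Qed.

Lemma flowyZ e c t x y : fy (e * c) t (e * x) (e * y) = e * fy c t x y.
Proof. by rewrite /flowy; ring. Qed.

Lemma spiral_re_turn : spiral_re l m (T + T) = q ^+ 2.
Proof.
by rewrite spiral_reD spiral_re_halfturn// spiral_im_halfturn// mulr0 subr0 mulrNN.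
Qed.

Lemma spiral_im_turn : spiral_im l m (T + T) = 0.
Proof. by rewrite spiral_imD spiral_im_halfturn// mulr0 mul0r addr0. Qed.

Let turn_spiral s t : s + t = T ->
  spiral_re l m s * spiral_re l m t - spiral_im l m s * spiral_im l m t = - q /\
  spiral_im l m s * spiral_re l m t + spiral_re l m s * spiral_im l m t = 0.
Proof.
by move=> st; rewrite -spiral_reD -spiral_imD st spiral_re_halfturn// spiral_im_halfturn.
Qed.

(** The two steps of control [c] last a half turn together, so the three steps have linear part
    [e^(2 alpha T) = q^2] whatever the controls. *)
Lemma flowx_turn c c' s t x y x' y' : s + t = T ->
  fx c s (fx c' T (fx c t x y) (fy c t x y)) (fy c' T (fx c t x y) (fy c t x y)) =
  fx c s (fx c' T (fx c t x' y') (fy c t x' y')) (fy c' T (fx c t x' y') (fy c t x' y'))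
  + q ^+ 2 * (x - x').
Proof.
move=> /turn_spiral[]; rewrite /flowx /flowy spiral_re_halfturn// spiral_im_halfturn//.
move: (spiral_re l m s) (spiral_im l m s) (spiral_re l m t) (spiral_im l m t).
move=> a b a' b' e1 e2.
apply: subr0_eq; rewrite opprD addrA; apply/eqP; rewrite subr_eq add0r; apply/eqP.
transitivity (- q * ((a * a' - b * b') * (x - x') - (b * a' + a * b') * (y - y'))).
  by ring.
by rewrite e1 e2; ring.
Qed.

Lemma flowy_turn c c' s t x y x' y' : s + t = T ->
  fy c s (fx c' T (fx c t x y) (fy c t x y)) (fy c' T (fx c t x y) (fy c t x y)) =
  fy c s (fx c' T (fx c t x' y') (fy c t x' y')) (fy c' T (fx c t x' y') (fy c t x' y'))
  + q ^+ 2 * (y - y').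
Proof.
move=> /turn_spiral[]; rewrite /flowx /flowy spiral_re_halfturn// spiral_im_halfturn//.
move: (spiral_re l m s) (spiral_im l m s) (spiral_re l m t) (spiral_im l m t).
move=> a b a' b' e1 e2.
apply: subr0_eq; rewrite opprD addrA; apply/eqP; rewrite subr_eq add0r; apply/eqP.
transitivity (- q * ((b * a' + a * b') * (x - x') + (a * a' - b * b') * (y - y'))).
  by ring.
by rewrite e1 e2; ring.
Qed.

Hypothesis l_lt0 : l < 0.

Let q1 : 1 - q != 0. Proof. by rewrite subr_eq0 gt_eqF// decay_lt1. Qed.

Lemma orbitx_halfturn : orbitx l m T = - orbitx l m 0.
Proof.
have N0 := sqmod_neq0 l m_gt0.
rewrite /orbitx flowx0 /flowx spiral_re_halfturn// spiral_im_halfturn// /apex.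
by field; rewrite q1 N0.
Qed.

Lemma orbity_halfturn : orbity l m T = - orbity l m 0.
Proof.
have N0 := sqmod_neq0 l m_gt0.
rewrite /orbity flowy0 /flowy spiral_re_halfturn// spiral_im_halfturn// /apex.
by field; rewrite q1 N0.
Qed.

Lemma flowx_orbit t s : fx 1 t (orbitx l m s) (orbity l m s) = orbitx l m (t + s).
Proof. by rewrite /orbitx flowxD. Qed.

Lemma flowy_orbit t s : fy 1 t (orbitx l m s) (orbity l m s) = orbity l m (t + s).
Proof. by rewrite /orbity flowyD. Qed.

End PlanarFlow.

Section Reachability.
Context {R : realType}.
Variables (A : 'M[R]_2) (eta : 'cV[R]_2) (l m um up : R).
Hypotheses (m_gt0 : 0 < m) (um_lt_up : um < up) (eta_neq0 : eta != 0).
Hypotheses (trA : \tr A = 2 * l) (detA : \det A = l ^+ 2 + m ^+ 2).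
Hypothesis l_lt0 : l < 0.
Implicit Types (v w : 'cV[R]_2) (s t c x y : R).

Local Notation Omega := `[um, up]%classic.
Local Notation cx := (coordx A eta l m um up).
Local Notation cy := (coordy A eta l m um up).
Local Notation pt := (of_coord A eta l m um up).
Local Notation lev := (level A eta l m um up).
Local Notation ctr := (center A eta um up).
Local Notation fl := (flow A eta l m um up).
Local Notation Orb := (positive_orbit A eta Omega).
Local Notation nu := (normalized um up).
Local Notation T := (halfturn m).
Local Notation q := (decay l m).

Let ptK v : pt (cx v) (cy v) = v. Proof. exact: of_coordK. Qed.
Let cxK x y : cx (pt x y) = x. Proof. exact: coordxK. Qed.
Let cyK x y : cy (pt x y) = y. Proof. exact: coordyK. Qed.

Let um_in : Omega um. Proof. by rewrite /= in_itv /= lexx ltW. Qed.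
Let up_in : Omega up. Proof. by rewrite /= in_itv /= lexx andbT ltW. Qed.

Lemma control_of_normalized k : `|k| <= 1 -> exists2 c, Omega c & nu c = k.
Proof.
rewrite ler_norml => /andP[k1 k2]; have r0 := control_rad_gt0 um_lt_up.
exists (control_mid um up + k * control_rad um up); last first.
  by rewrite /normalized addrAC subrr add0r mulfK// gt_eqF.
have a1 : - control_rad um up <= k * control_rad um up.
  by rewrite -mulN1r ler_pM2r.
have a2 : k * control_rad um up <= control_rad um up.
  by rewrite -{2}[control_rad _ _]mul1r ler_pM2r.
rewrite /= in_itv /=; move: a1 a2; move: (k * _) => z.
by rewrite /control_mid /control_rad => a1 a2; apply/andP; split; lra.
Qed.

(* A loop in the control space contracts the plane towards its fixed point,
   which is therefore approached from everywhere. *)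
Lemma closure_fixed_point (loop : 'cV[R]_2 -> 'cV[R]_2) w k v :
  (forall v v', Orb v v' -> Orb v (loop v')) -> `|k| < 1 ->
  (forall v, cx (loop v) = cx w + k * (cx v - cx w)) ->
  (forall v, cy (loop v) = cy w + k * (cy v - cy w)) ->
  closure (Orb v) w.
Proof.
move=> hO k1 hx hy B Bw.
have itx n : cx (iter n loop v) = cx w + k ^+ n * (cx v - cx w).
  by elim: n => [|n IHn]; [rewrite expr0 /=; ring|rewrite iterS hx IHn exprS; ring].
have ity n : cy (iter n loop v) = cy w + k ^+ n * (cy v - cy w).
  by elim: n => [|n IHn]; [rewrite expr0 /=; ring|rewrite iterS hy IHn exprS; ring].
have itO n : Orb v (iter n loop v).
  elim: n => [|n IHn]; first exact: (positive_orbit_refl (l := l) (m := m)).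
  by rewrite iterS; exact: hO.
have lim : (fun n => iter n loop v) @ \oo --> w.
  rewrite (_ : (fun n => _) = (fun n => pt (cx w + k ^+ n * (cx v - cx w))
      (cy w + k ^+ n * (cy v - cy w)))); last first.
    by apply/funext => n; rewrite -itx -ity ptK.
  rewrite -[X in _ --> X]ptK.
  have ex z z' : z + k ^+ n * z' @[n --> \oo] --> z.
    have h : z + k ^+ n * z' @[n --> \oo] --> z + 0 * z'.
      by apply: cvgD; [exact: cvg_cst|apply: cvgMr_tmp; exact: cvg_expr].
    by rewrite mul0r addr0 in h.
  exact: cvg_of_coord.
have [n _ hn] := lim B Bw.
by exists (iter n loop v); split; [exact: itO|exact: (hn n (leqnn n))].
Qed.

Lemma nu_mid : nu (control_mid um up) = 0.
Proof. by rewrite /normalized subrr mul0r. Qed.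

Let mid_in : Omega (control_mid um up).
Proof.
have h := um_lt_up; rewrite /= in_itv /= /control_mid.
by apply/andP; split; lra.
Qed.

Let q2_lt1 : `|q ^+ 2| < 1.
Proof.
have q0 := decay_gt0 l m.
by rewrite ger0_norm ?exprn_ge0 ?(ltW q0)// exprn_ilt1 ?(ltW q0)// decay_lt1.
Qed.

Let coordx_mean_turn v : cx (fl (control_mid um up) (T + T) v) = q ^+ 2 * cx v.
Proof.
rewrite coordx_flow// nu_mid /flowx spiral_re_turn// spiral_im_turn//.
by ring.
Qed.

Let coordy_mean_turn v : cy (fl (control_mid um up) (T + T) v) = q ^+ 2 * cy v.
Proof.
rewrite coordy_flow// nu_mid /flowy spiral_re_turn// spiral_im_turn//.
by ring.
Qed.

(** A full turn with the mean control contracts towards its equilibrium by the factor [q^2]. *)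
Lemma closure_orbit_center v : closure (Orb v) ctr.
Proof.
have T0 := halfturn_gt0 m_gt0.
apply: (@closure_fixed_point (fl (control_mid um up) (T + T)) ctr (q ^+ 2)) => //.
- by move=> v1 v2 h; apply: positive_orbit_flow => //; rewrite addr_ge0 ?ltW.
- by move=> v'; rewrite coordx_mean_turn coordx_center// subr0 add0r.
- by move=> v'; rewrite coordy_mean_turn coordy_center// subr0 add0r.
Qed.

(* The loop runs once through the periodic orbit starting from [w]. *)
Lemma closure_orbit_level1 v w : lev w = 1 -> closure (Orb v) w.
Proof.
move=> w1; have T0 := halfturn_gt0 m_gt0.
have [s /andP[s0 sT] hw] := gauge_eq1_orbit m_gt0 l_lt0 w1.
(* [e] is the sign of the arc containing [w], and also the normalized control that drives this
   arc. *)
have [e [e1 wx wy]] : exists e : R,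
    [/\ `|e| = 1, cx w = e * orbitx l m s & cy w = e * orbity l m s].
  case: hw => [[-> ->]|[-> ->]]; [exists 1|exists (-1)].
    by rewrite normr1 !mul1r.
  by rewrite normrN1 !mulN1r.
have [a aO na] : exists2 c, Omega c & nu c = e.
  by apply: control_of_normalized; rewrite e1.
have [b bO nb] : exists2 c, Omega c & nu c = - e.
  by apply: control_of_normalized; rewrite normrN e1.
have Ts : s + (T - s) = T by rewrite addrC subrK.
(* Finish the arc of [w], run through the opposite arc, then return to [w]. *)
pose loop v := fl a s (fl b T (fl a (T - s) v)).
have fixw : loop w = w.
  have fa t r : fl a t (pt (e * orbitx l m r) (e * orbity l m r)) =
      pt (e * orbitx l m (t + r)) (e * orbity l m (t + r)).
    rewrite /flow !cxK !cyK na -{1 4}[e]mulr1 flowxZ flowyZ.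
    by rewrite flowx_orbit flowy_orbit.
  have fb : fl b T (pt (e * orbitx l m T) (e * orbity l m T)) =
      pt (e * orbitx l m 0) (e * orbity l m 0).
    rewrite orbitx_halfturn// orbity_halfturn// !mulrN -!mulNr.
    rewrite /flow !cxK !cyK nb -{1 4}[- e]mulr1 flowxZ flowyZ.
    rewrite flowx_orbit flowy_orbit addr0 orbitx_halfturn// orbity_halfturn//.
    by rewrite !mulrNN.
  by rewrite -[w]ptK wx wy /loop fa subrK fb fa addr0.
apply: (@closure_fixed_point loop w (q ^+ 2)) => //.
- move=> v1 v2 h; apply: positive_orbit_flow => //; apply: positive_orbit_flow => //.
    by apply: positive_orbit_flow => //; rewrite subr_ge0.
  exact: ltW.
- move=> v'; rewrite -{1}fixw /loop !(coordx_flow, coordy_flow)//.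
  exact: flowx_turn.
- move=> v'; rewrite -{1}fixw /loop !(coordx_flow, coordy_flow)//.
  exact: flowy_turn.
Qed.

Lemma continuous_flow_point c t : continuous (fl c t).
Proof.
move=> v; change (fl c t @ nbhs v --> fl c t v).
have hx : cx @ nbhs v --> cx v by exact: continuous_coordx.
have hy : cy @ nbhs v --> cy v by exact: continuous_coordy.
have sx k : cx w + k @[w --> nbhs v] --> cx v + k.
  by apply: cvgD => //; exact: cvg_cst.
have sy k : cy w - k @[w --> nbhs v] --> cy v - k.
  by apply: cvgB => //; exact: cvg_cst.
apply: cvg_of_coord; rewrite /flowx /flowy.
  by apply: cvgB; [apply: cvgB; exact: cvgMl_tmp|exact: cvg_cst].
by apply: cvgD; [apply: cvgD; exact: cvgMl_tmp|exact: cvg_cst].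
Qed.

(** The flow is continuous in its starting point, so a further control step may be applied to a
    limit point. *)
Lemma closure_orbit_flow v w c t : Omega c -> 0 <= t ->
  closure (Orb v) w -> closure (Orb v) (fl c t w).
Proof.
move=> cO t0 vw B /continuous_flow_point Bw.
have [w' [vw' Bw']] := vw _ Bw.
by exists (fl c t w'); split=> //; exact: positive_orbit_flow.
Qed.

(* Run backwards with the mean control, every point other than the centre
   reaches the periodic orbit. *)
Lemma closure_orbit_level_le1 v w : lev w <= 1 -> closure (Orb v) w.
Proof.
move=> w1; have T0 := halfturn_gt0 m_gt0.
have [->|wc] := eqVneq w ctr; first exact: closure_orbit_center.
have w0 : 0 < lev w.
  apply: gauge_gt0 => //; rewrite -negb_and; apply: contra_neqN wc => /andP[/eqP ex /eqP ey].
  by apply: (coord_inj m_gt0 um_lt_up eta_neq0 trA detA); rewrite ?coordx_center ?coordy_center.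
pose f t := lev (fl (control_mid um up) (- t) w).
have cf : continuous f.
  move=> t; apply: (cvg_comp (fun t => fl (control_mid um up) (- t) w) lev);
    last exact: continuous_level.
  apply: (cvg_comp (fun t : R => - t) (fun t => fl (control_mid um up) t w));
    last exact: continuous_flow.
  by apply: cvgN; exact: cvg_id.
have f0 : f 0 = lev w by rewrite /f oppr0 flow0.
(* A backward full turn divides the level by [q^2 < 1], so the level eventually exceeds 1 and takes
   the value 1 on the way. *)
have fT t : f (t + (T + T)) = f t / q ^+ 2.
  have q0 : q ^+ 2 != 0 by rewrite expf_neq0// gt_eqF// decay_gt0.
  apply: (mulIf q0); rewrite divfK//.
  rewrite {2}/f (_ : - t = (T + T) - (t + (T + T))); last by ring.
  rewrite flowD// /level coordx_mean_turn coordy_mean_turn gaugeZ//.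
  by rewrite ger0_norm ?sqr_ge0// mulrC.
have fn n : f ((T + T) *+ n) = lev w / (q ^+ 2) ^+ n.
  elim: n => [|n IHn]; first by rewrite mulr0n f0 expr0 divr1.
  by rewrite mulrSr fT IHn (exprSr (q ^+ 2) n) (invfM ((q ^+ 2) ^+ n)) mulrA.
have [n hn] : exists n, (q ^+ 2) ^+ n < lev w.
  have /cvgr0Pnorm_lt/(_ _ w0)[n _ hn] := cvg_expr q2_lt1.
  exists n; have := hn n (leqnn n); rewrite /= ger0_norm//.
  by rewrite exprn_ge0// sqr_ge0.
have qn : 0 < (q ^+ 2) ^+ n by rewrite !exprn_gt0// decay_gt0.
have Tn : 0 <= (T + T) *+ n by rewrite mulrn_wge0// addr_ge0// ltW.
have [t /= + ft] : exists2 t, t \in `[0, (T + T) *+ n] & f t = 1.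
  apply: IVT => //; first exact: continuous_subspaceT.
  rewrite f0 fn ge_min le_max w1 /=; apply/orP; right.
  by rewrite ler_pdivlMr// mul1r ltW.
rewrite in_itv /= => /andP[t0 _].
have -> : w = fl (control_mid um up) t (fl (control_mid um up) (- t) w).
  by rewrite -flowD// subrr flow0.
by apply: closure_orbit_flow => //; exact: closure_orbit_level1.
Qed.

End Reachability.

(** * Local controllability by two short steps *)

Section TwoSteps.
Context {R : realType}.
Variables (A : 'M[R]_2) (eta : 'cV[R]_2) (l m um up : R).
Hypotheses (m_gt0 : 0 < m) (um_lt_up : um < up) (eta_neq0 : eta != 0).
Hypotheses (trA : \tr A = 2 * l) (detA : \det A = l ^+ 2 + m ^+ 2).
Hypothesis l_lt0 : l < 0.
Implicit Types (v w : 'cV[R]_2) (s t c x y : R).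

Local Notation Omega := `[um, up]%classic.
Local Notation cx := (coordx A eta l m um up).
Local Notation cy := (coordy A eta l m um up).
Local Notation lev := (level A eta l m um up).
Local Notation fl := (flow A eta l m um up).
Local Notation nu := (normalized um up).
Local Notation T := (halfturn m).

Let flowx_affine c t x y : flowx l m c t x y =
  spiral_re l m t * x - spiral_im l m t * y + c * flowx l m 1 t 0 0.
Proof. by rewrite /flowx; ring. Qed.

Let flowy_affine c t x y : flowy l m c t x y =
  spiral_im l m t * x + spiral_re l m t * y + c * flowy l m 1 t 0 0.
Proof. by rewrite /flowy; ring. Qed.

(** With [g] the point reached from 0 under the control 1, this is up to sign the determinant of
    [e^(alpha t) g] and [g], the effects of the first and the second control. Here [g] is nonzero
    because [alpha g = e^(alpha t) - 1] has imaginary part [spiral_im t > 0]. *)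
Let steer_neq0 t : 0 < t < T ->
  spiral_im l m t * (flowx l m 1 t 0 0 ^+ 2 + flowy l m 1 t 0 0 ^+ 2) != 0.
Proof.
move=> /andP[t0 tT].
have im0 : spiral_im l m t != 0.
  rewrite gt_eqF// mulr_gt0 ?expR_gt0// sin_gt0_pi//.
  by rewrite mulr_gt0//= -(mul_halfturn m_gt0) ltr_pM2l.
rewrite mulf_neq0// paddr_eq0 ?sqr_ge0// !expf_eq0 /=.
apply: contraNN im0 => /andP[/eqP gx /eqP gy].
have -> : spiral_im l m t = l * flowy l m 1 t 0 0 + m * flowx l m 1 t 0 0.
  have N0 := sqmod_neq0 l m_gt0; rewrite /sqmod in N0.
  by rewrite /flowx /flowy /sqmod; field.
by rewrite gx gy !mulr0 addr0.
Qed.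

(* The end point of two steps of equal length is an invertible affine function
   of the two controls, so every point near the one that the mean control sends
   to [v] can be sent to [v] too. *)
Lemma two_step_control v : lev v < 1 -> exists w0, lev w0 < 1 /\
  nbhs w0 [set w | exists c1 c2 t,
    [/\ Omega c1, Omega c2, 0 <= t & v = fl c2 t (fl c1 t w)]].
Proof.
move=> v1; have T0 := halfturn_gt0 m_gt0; pose mid := control_mid um up.
(* A small [t] keeps the point that the mean control leads to [v] inside the region. *)
have [t [t0 tT lev1]] : exists t, [/\ 0 < t, t < T & lev (fl mid (- (t + t)) v) < 1].
  have h : lev (fl mid (- (t + t)) v) @[t --> 0^'+] --> lev (fl mid (- (0 + 0)) v).
    apply: cvg_at_right_filter.
    apply: (cvg_comp (fun t => fl mid (- (t + t)) v) lev);
    last exact: continuous_level.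
    apply: (cvg_comp (fun t : R => - (t + t)) (fun t => fl mid t v));
    last exact: continuous_flow.
    by apply: cvgN; apply: cvgD; exact: cvg_id.
  rewrite addr0 oppr0 flow0// in h.
  have h1 := cvgr_lt _ h _ v1.
  near (0 : R)^'+ => t; exists t; split; near: t.
  - exact: nbhs_right_gt.
  - exact: nbhs_right_lt.
  - exact: h1.
pose w0 := fl mid (- (t + t)) v; exists w0; split=> //.
have back : v = fl mid t (fl mid t w0).
  by rewrite -flowD// /w0 -flowD// subrr flow0.
clearbody w0.
pose re := spiral_re l m t; pose im := spiral_im l m t.
pose gx := flowx l m 1 t 0 0; pose gy := flowy l m 1 t 0 0.
have D0 : im * (gx ^+ 2 + gy ^+ 2) != 0 by apply: steer_neq0; rewrite t0.
(* [E + i G] is [e^(2 alpha t)], and [D] is the determinant of the linear system for the two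
   controls. *)
pose E := re ^+ 2 - im ^+ 2; pose G := 2 * re * im.
pose D := - (im * (gx ^+ 2 + gy ^+ 2)).
have fxa c x y : flowx l m c t x y = re * x - im * y + c * gx.
  exact: flowx_affine.
have fya c x y : flowy l m c t x y = im * x + re * y + c * gy.
  exact: flowy_affine.
clearbody re im gx gy.
have D1 : (gx ^+ 2 + gy ^+ 2 != 0) && (im != 0).
  by move: D0; rewrite mulf_eq0 negb_or andbC.
(* The vector [(rx, ry)] is the displacement left to the controls; [U1] and [U2] solve the system by
   Cramer's rule and vanish at [w0]. *)
pose rx w := cx v - (E * cx w - G * cy w).
pose ry w := cy v - (G * cx w + E * cy w).
pose U1 w := (rx w * gy - ry w * gx) / D.
pose U2 w := ((re * gx - im * gy) * ry w - (im * gx + re * gy) * rx w) / D.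
have nu0 : nu mid = 0 by exact: nu_mid.
have rx0 : rx w0 = 0.
  rewrite /rx {1}back !(coordx_flow, coordy_flow)// nu0 !fxa !fya.
  by rewrite /E /G; ring.
have ry0 : ry w0 = 0.
  rewrite /ry {1}back !(coordx_flow, coordy_flow)// nu0 !fxa !fya.
  by rewrite /E /G; ring.
have hx : cx @ nbhs w0 --> cx w0 by exact: continuous_coordx.
have hy : cy @ nbhs w0 --> cy w0 by exact: continuous_coordy.
have hrx : rx @ nbhs w0 --> rx w0.
  by apply: cvgB; [exact: cvg_cst|apply: cvgB; exact: cvgMl_tmp].
have hry : ry @ nbhs w0 --> ry w0.
  by apply: cvgB; [exact: cvg_cst|apply: cvgD; exact: cvgMl_tmp].
have hU1 : U1 @ nbhs w0 --> 0.
  have -> : 0 = U1 w0 by rewrite /U1 rx0 ry0 !mul0r subr0 mul0r.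
  by apply: cvgMr_tmp; apply: cvgB; exact: cvgMr_tmp.
have hU2 : U2 @ nbhs w0 --> 0.
  have -> : 0 = U2 w0 by rewrite /U2 rx0 ry0 !mulr0 subr0 mul0r.
  by apply: cvgMr_tmp; apply: cvgB; exact: cvgMl_tmp.
have /cvgr0Pnorm_lt/(_ _ ltr01) near1 := hU1.
have /cvgr0Pnorm_lt/(_ _ ltr01) near2 := hU2.
apply: filterS2 near1 near2 => w u1 u2.
have [c1 c1O n1] := control_of_normalized um_lt_up (ltW u1).
have [c2 c2O n2] := control_of_normalized um_lt_up (ltW u2).
exists c1, c2, t; split=> //; first exact: ltW.
apply: (coord_inj m_gt0 um_lt_up eta_neq0 trA detA);
  rewrite !(coordx_flow, coordy_flow)// n1 n2 !fxa !fya.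
  rewrite /U1 /U2 /rx /ry /D /E /G.
  by field.
rewrite /U1 /U2 /rx /ry /D /E /G.
by field.
Unshelve. all: by end_near. Qed.

End TwoSteps.

(** * Control sets *)

Section ControlSets.
Context {R : realType}.
Variables (A : 'M[R]_2) (eta : 'cV[R]_2) (l m um up : R).
Hypotheses (m_gt0 : 0 < m) (um_lt_up : um < up) (eta_neq0 : eta != 0).
Hypotheses (trA : \tr A = 2 * l) (detA : \det A = l ^+ 2 + m ^+ 2).
Hypothesis l_lt0 : l < 0.

Local Notation Omega := `[um, up]%classic.
Local Notation Orb := (positive_orbit A eta Omega).
Local Notation lev := (level A eta l m um up).
Local Notation ctr := (center A eta um up).
Local Notation fl := (flow A eta l m um up).
Local Notation mid := (control_mid um up).

Let um_in : Omega um. Proof. by rewrite /= in_itv /= lexx ltW. Qed.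

Lemma positive_orbit_phi (v : 'cV[R]_2) u x (s : R) : control_functions Omega u ->
  is_phi A eta v u x -> 0 <= s -> Orb v (x s).
Proof. by move=> hu hx s0; exists u, x, s. Qed.

(** For maximality: a larger set contains [center], hence lies in the closure of its orbit, and the
    closed invariant ball contains that closure. *)
Lemma stable_control_set : control_set A eta Omega [set v | lev v <= 1].
Proof.
have c1 : [set v | lev v <= 1] ctr by rewrite /= level_center// ler01.
split.
- move=> v v1; have hu := control_cst um_in.
  have hx := flow_is_phi m_gt0 um_lt_up eta_neq0 trA detA um v.
  exists (cst um), (fun t => fl um t v); split=> // s s0.
  have vs := positive_orbit_phi hu hx s0.
  by apply: positive_orbit_level_le1 v1; last exact: vs.
- by move=> v v1 w; exact: closure_orbit_level_le1.
- move=> D _ reach sub; apply/seteqP; split=> // w Dw.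
  have : closure (Orb ctr) w by apply: reach => //; exact: sub.
  have /closure_id -> : closed [set v | lev v <= 1] by exact: closed_level_le1.
  by apply: closureS => x cx; exact: positive_orbit_level_le1 cx c1.
Qed.

(** * The time-reversed system *)

Section Reversed.
Variables (B : 'M[R]_2) (xi : 'cV[R]_2).
Hypotheses (BA : - B = A) (xieta : - xi = eta).
Local Notation OrbB := (positive_orbit B xi Omega).

Let reverse_orbit v w : OrbB v w -> Orb w v.
Proof. by move=> /positive_orbit_time_reversal; rewrite BA xieta. Qed.

Let unreverse_orbit v w : Orb w v -> OrbB v w.
Proof.
by move=> /positive_orbit_time_reversal; rewrite -BA -xieta !opprK.
Qed.

(** For [A], the orbit of [w] comes arbitrarily near [w0]; two free steps correct the remaining
    error exactly, and time reversal turns this trajectory from [w] to [v] into one from [v] to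
    [w]. *)
Let reversed_orbit_region v w : lev v < 1 -> lev w < 1 -> OrbB v w.
Proof.
move=> v1 w1; apply: unreverse_orbit.
have [w0 [w01 near_w0]] :=
  two_step_control m_gt0 um_lt_up eta_neq0 trA detA l_lt0 v1.
have cl : closure (Orb w) w0.
  by apply: (closure_orbit_level_le1 m_gt0 um_lt_up eta_neq0 trA detA l_lt0); exact: ltW.
have [w' [ww' [c1 [c2 [t [c1O c2O t0 ->]]]]]] := cl _ near_w0.
by do 2 apply: positive_orbit_flow => //.
Qed.

Let trB : \tr B = 2 * - l.
Proof. by rewrite -[B]opprK BA raddfN /= trA mulrN. Qed.

Let detB : \det B = (- l) ^+ 2 + m ^+ 2.
Proof. by rewrite sqrrN -detA -BA !det_mx2 !mxE; ring. Qed.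

Let xi_neq0 : xi != 0. Proof. by rewrite -oppr_eq0 xieta. Qed.

(** Reversal keeps the equilibrium of the mean control, so a trajectory that has reached it can rest
    there forever. *)
Let flow_center t : flow B xi (- l) m um up mid t ctr = ctr.
Proof.
have hc : is_phi B xi ctr (cst mid) (cst ctr).
  split=> //; first by move=> s; exact: cvg_cst.
  move=> s _; apply: is_derive_eq.
  rewrite -[B]opprK -[xi]opprK BA xieta mulNmx (mulmx_center eta um up m_gt0 detA).
  by rewrite scaleNr scalerN opprK subrr.
by have /(congr1 (fun x => x t)) := flow_unique m_gt0 um_lt_up xi_neq0 trB detB hc.
Qed.

(* In reversed time the region is invariant, so a trajectory that ends at the
   centre cannot have left the region. *)
Lemma reversed_control_set : control_set B xi Omega [set v | lev v < 1].
Proof.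
have c1 : [set v | lev v < 1] ctr by rewrite /= level_center// ltr01.
split.
- move=> v v1.
  (* Steer [v] to the centre, then stay there. *)
  have [u [x [s [hu hx s0 es]]]] := reversed_orbit_region v1 c1.
  have mid_in : Omega mid.
    have h := um_lt_up; rewrite /= in_itv /= /control_mid.
    by apply/andP; split; lra.
  have [u' [x' [hu' hx' x'l x'r]]] :=
    extend_by_constant m_gt0 um_lt_up xi_neq0 trB detB hu hx s0 mid_in.
  exists u', x'; split=> // t t0; have [ts|st] := lerP t s; last first.
    by rewrite (x'r t (ltW st)) -es flow_center.
  rewrite x'l// -[t](subKr s).
  have st : 0 <= s - t by rewrite subr_ge0.
  have hr := is_phi_time_reversal s hx; rewrite BA xieta -es in hr.
  have h := positive_orbit_phi (control_functions_time_reversal s hu) hr st.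
  exact: positive_orbit_level_lt1 h c1.
- by move=> v v1 w w1; apply: subset_closure; exact: reversed_orbit_region.
- move=> D _ reach sub; apply/seteqP; split=> // w Dw /=.
  have nc : nbhs ctr (region A eta l m um up).
    by apply: open_nbhs_nbhs; split=> //; exact: open_region.
  (* From a point of [D] some point of the region is reached; run backwards, this trajectory starts
     in the region and cannot leave it. *)
  have [w' [ww' w'1]] := reach w Dw _ (sub _ c1) _ nc.
  exact: positive_orbit_level_lt1 (reverse_orbit ww') w'1.
Qed.

End Reversed.
End ControlSets.

(** * The periodic orbit under time reversal *)

Section OrbitReversal.
Context {R : realType}.

Lemma decay_neq1 (l m : R) : 0 < m -> l != 0 -> 1 - decay l m != 0.
Proof.
move=> m0 l0; rewrite subr_eq0 eq_sym -[X in _ == X]expR0 (inj_eq (@expR_inj R)).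
by rewrite mulf_neq0 ?invr_eq0 ?(lt0r_neq0 m0)// mulf_neq0// lt0r_neq0// pi_gt0.
Qed.

(** Reversal replaces [q] by [q^-1]; multiplying numerator and denominator by [- q] then exchanges
    [a] and [b]. *)
Lemma switch_point_reversal (A : 'M[R]_2) (eta : 'cV[R]_2) (l m a b : R) :
  A \in unitmx -> l != 0 -> 0 < m ->
  switch_point (- A) (- eta) (- l) m a b = switch_point A eta l m b a.
Proof.
move=> uA l0 m0; rewrite /switch_point.
have -> : invmx (- A) *m (- eta) = invmx A *m eta.
  have uNA : - A \in unitmx by rewrite -scaleN1r unitmxZ ?unitrN1.
  by apply: (can_inj (mulKmx uNA)); rewrite mulKVmx// mulNmx mulKVmx.
congr (_ *: _); rewrite mulrN mulNr expRN.
have q1 : 1 - expR (pi * l / m) != 0 by exact: decay_neq1.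
have q0 : expR (pi * l / m) != 0 by rewrite gt_eqF ?expR_gt0.
have q1' : expR (pi * l / m) - 1 != 0 by rewrite -opprB oppr_eq0.
move: (expR _) q1 q0 q1' => q q1 q0 q1'.
by field; rewrite q1 q0 q1'.
Qed.

Variables (A : 'M[R]_2) (eta : 'cV[R]_2) (l m um up : R).
Hypotheses (m_gt0 : 0 < m) (um_lt_up : um < up) (eta_neq0 : eta != 0).
Hypotheses (trA : \tr A = 2 * l) (detA : \det A = l ^+ 2 + m ^+ 2).
Hypothesis l_neq0 : l != 0.

(** The half turn multiplies by [- q] about the equilibrium of the control [b], which sends one
    switch point to the other for either sign of [l]. *)
Lemma switch_point_halfturn a b x :
  is_phi A eta (switch_point A eta l m a b) (cst b) x ->
  x (pi / m) = switch_point A eta l m b a.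
Proof.
move=> /(flow_unique m_gt0 um_lt_up eta_neq0 trA detA) ->.
have q1 : 1 - expR (pi * l / m) != 0 by exact: decay_neq1.
have r0 : control_rad um up != 0 by rewrite gt_eqF ?control_rad_gt0.
rewrite /switch_point !(scale_center_of_coord eta m_gt0 um_lt_up trA detA).
rewrite /flow coordxK// coordyK// -/(halfturn m) /flowx /flowy.
rewrite spiral_re_halfturn// spiral_im_halfturn// /normalized -/(decay l m).
have N0 := sqmod_neq0 l m_gt0; have q1' : 1 - decay l m != 0 by [].
by congr of_coord; field; rewrite q1' N0 r0.
Qed.

(** The same arc is run backwards from its other end, which is the switch point of the reversed
    system. *)
Lemma constant_arc_reversal a b :
  constant_arc A eta m (switch_point A eta l m a b) b `<=`
  constant_arc (- A) (- eta) m (switch_point (- A) (- eta) (- l) m a b) b.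
Proof.
move=> _ [x [s [hx + ->]]]; rewrite in_itv /= => /andP[s0 sT].
exists (fun t => x (pi / m - t)), (pi / m - s); split.
- have := is_phi_time_reversal (pi / m) hx.
  rewrite (switch_point_halfturn hx) switch_point_reversal//.
  exact: unitA detA.
- by rewrite in_itv /= subr_ge0 sT /= gerBl.
- by rewrite subKr.
Qed.

End OrbitReversal.

Lemma periodic_orbit_reversal (R : realType) (A : 'M[R]_2) (eta : 'cV[R]_2)
    (l m um up : R) : 0 < m -> um < up -> eta != 0 -> \tr A = 2 * l ->
  \det A = l ^+ 2 + m ^+ 2 -> l != 0 ->
  periodic_orbit A eta l m um up = periodic_orbit (- A) (- eta) (- l) m um up.
Proof.
move=> m0 umup eta0 trA detA l0.
have eta0' : - eta != 0 by rewrite oppr_eq0.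
have trA' : \tr (- A) = 2 * - l by rewrite raddfN /= trA mulrN.
have detA' : \det (- A) = (- l) ^+ 2 + m ^+ 2.
  by rewrite sqrrN -detA !det_mx2 !mxE; ring.
have l0' : - l != 0 by rewrite oppr_eq0.
have arc a b : constant_arc A eta m (switch_point A eta l m a b) b =
    constant_arc (- A) (- eta) m (switch_point (- A) (- eta) (- l) m a b) b.
  apply/seteqP; split.
    exact: (constant_arc_reversal m0 umup eta0 trA detA l0).
  have := @constant_arc_reversal _ _ _ _ _ _ _ m0 umup eta0' trA' detA' l0' a b.
  by rewrite !opprK.
by rewrite /periodic_orbit !arc.
Qed.

Theorem theorem3p5 (R : realType) (A : 'M[R]_2) (eta : 'cV[R]_2)
    (um up lambda mu : R)
    (hdet : (\tr A) ^+ 2 - 4 * \det A < 0)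
    (htr : \tr A != 0)
    (heta : eta != 0)
    (hum : um < up)
    (hmu : 0 < mu)
    (heig : complex_eigenvalues A lambda mu) :
  let Omega := `[um, up]%classic in
  let C := closure (delimited_region (periodic_orbit A eta lambda mu um up)) in
  (\tr A < 0 -> control_set A eta Omega C) /\
  (0 < \tr A -> control_set A eta Omega (interior C)).
Proof.
move=> Omega C; have [trA detA] := complex_eigenvalues_tr_det hmu heig.
split=> [trA_lt0|trA_gt0].
  have l0 : lambda < 0 by rewrite trA pmulr_rlt0 in trA_lt0.
  rewrite /C delimited_regionE// closure_region//.
  exact: stable_control_set.
have l0 : 0 < lambda by rewrite trA pmulr_rgt0 in trA_gt0.
have l0' : - lambda < 0 by rewrite oppr_lt0.
have eta0' : - eta != 0 by rewrite oppr_eq0.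
have trA' : \tr (- A) = 2 * - lambda by rewrite raddfN /= trA mulrN.
have detA' : \det (- A) = (- lambda) ^+ 2 + mu ^+ 2.
  by rewrite sqrrN -detA !det_mx2 !mxE; ring.
(* The orbit is rewritten for [(- A, - eta)], whose eigenvalues have negative real part. *)
rewrite /C periodic_orbit_reversal ?(lt0r_neq0 l0)//.
rewrite delimited_regionE// closure_region// interior_level_le1//.
exact: (reversed_control_set hmu hum eta0' trA' detA' l0').
Qed.
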